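(* For every positive integer $p$ there exists a constant $\epsilon_p>0$ such that the following holds. If $n$ and $\delta$ are positive integers with $(1-1/(p+1)-\epsilon_p)n<\delta\le(1-1/(p+1))n$ and $\delta=(1-\beta)n$, then $k_r(n,\delta)\ge g_r(\beta)n^r$ for every positive integer $r$. Moreover, for $3\le r\le p+1$, equality holds if and only if $(n,\beta)$ is feasible, and the graphs of order $n$ and minimum degree $\delta$ attaining equality are exactly the members of $\mathcal{G}(n,\beta)$.
   Context: All graphs are finite and simple; $k_r(G)$ is the number of $r$-cliques of $G$, and $k_r(n,\delta)$ is the minimum of $k_r(G)$ over all graphs $G$ of order $n$ with minimum degree $\delta$. Throughout, $\delta=(1-\beta)n$ with $0<\beta<1$, and $p=\lceil \beta^{-1}\rceil-1$, so $1/(p+1)\le \beta<1/p$. For such $\beta$ and integers $r$, define $$g_r(\beta)=\binom{p-1}{r}\beta^{r}+\binom{p-1}{r-1}(1-(p-1)\beta)\beta^{r-1}+\frac12\binom{p-1}{r-2}(1-p\beta)(1-(p-1)\beta)\beta^{r-2},$$ where $\binom{x}{y}=0$ if $x<y$ or $y<0$. The family $\mathcal{G}(n,\beta)$ (defined only when $n$ and $(1-\beta)n$ are positive integers not both odd) consists of all graphs $G$ on vertex set $V$, $|V|=n$, admitting a partition $V=V_0\cup V_1\cup\dots\cup V_{p-1}$ with $|V_0|=(1-(p-1)\beta)n$ and $|V_i|=\beta n$ for $1\le i\le p-1$, such that: all edges between $V_i$ and $V_j$ are present for $0\le i<j\le p-1$; $V_i$ is independent for $1\le i\le p-1$; and $G[V_0]$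 is $(1-p\beta)n$-regular with minimum number of triangles among all $(1-p\beta)n$-regular graphs on $|V_0|$ vertices. The pair $(n,\beta)$ is feasible if $\mathcal{G}(n,\beta)$ is defined and $G[V_0]$ is triangle-free for $G\in\mathcal{G}(n,\beta)$. *)

(* Defs.v *)
(* Graphs: simple graphs on vertex set 'I_n given by a
   symmetric irreflexive relation. Real parameters are rationals (all
   quantities beta = 1 - delta/n etc. are rational). *)
From HB Require Import structures.
From mathcomp Require Import all_boot all_order all_algebra.
Unset Printing Implicit Defensive.
Import Order.TTheory GRing.Theory Num.Theory.

Local Open Scope ring_scope.

Definition binz (a : nat) (b : int) : rat :=
  match b with Posz k => ('C(a, k))%:R | Negz _ => 0 end.

Definition pof (beta : rat) : nat := `| Num.ceil (beta^-1) - 1 |%N.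

Definition g (r : nat) (beta : rat) : rat :=
  let p := pof beta in
  binz p.-1 r%:Z * beta ^+ r
  + binz p.-1 (r%:Z - 1) * (1 - (p.-1)%:R * beta) * beta ^+ r.-1
  + 2^-1 * binz p.-1 (r%:Z - 2) * (1 - p%:R * beta) * (1 - (p.-1)%:R * beta)
      * beta ^+ r.-2.

Definition beta_of (n delta : nat) : rat := 1 - delta%:R / n%:R.

Definition simple_graph {n : nat} (e : rel 'I_n) : Prop :=
  irreflexive e /\ symmetric e.

Definition deg {n : nat} (e : rel 'I_n) (x : 'I_n) : nat := #|[set y | e x y]|.

Definition min_degree_is {n : nat} (e : rel 'I_n) (d : nat) : Prop :=
  (forall x, (d <= deg e x)%N) /\ exists x, deg e x = d.

Definition is_clique {n : nat} (e : rel 'I_n) (S : {set 'I_n}) : bool :=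
  [forall x in S, forall y in S, (x != y) ==> e x y].

Definition kr {n : nat} (e : rel 'I_n) (r : nat) : nat :=
  #|[set S : {set 'I_n} | (#|S| == r) && is_clique e S]|.

Definition triangles {n : nat} (e : rel 'I_n) (S : {set 'I_n}) : nat :=
  #|[set T : {set 'I_n} | [&& T \subset S, #|T| == 3%N & is_clique e T]]|.

Definition family_defined (n delta : nat) : Prop :=
  (0 < n)%N /\ (0 < delta)%N /\ ~~ (odd n && odd delta).

Definition family_partition (n delta : nat) (e : rel 'I_n) (part : 'I_n -> nat)
  : Prop :=
  let beta := beta_of n delta in
  let p := pof beta in
  let V0 := [set x | part x == 0%N] in
  (forall x, (part x < p)%N) /\
      (#|V0|%:R : rat) = (1 - (p.-1)%:R * beta) * n%:R /\
      (forall i : nat, (0 < i < p)%N ->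
         (#|[set x | part x == i]|%:R : rat) = beta * n%:R) /\
      (forall x y, part x != part y -> e x y) /\
      (forall x y, part x = part y -> part x != 0%N -> ~~ e x y) /\
      (forall x, x \in V0 ->
         (#|[set y in V0 | e x y]|%:R : rat) = (1 - p%:R * beta) * n%:R) /\
      (forall (m : nat) (e' : rel 'I_m), simple_graph e' ->
         (m%:R : rat) = (1 - (p.-1)%:R * beta) * n%:R ->
         (forall x, ((deg e' x)%:R : rat) = (1 - p%:R * beta) * n%:R) ->
         (triangles e V0 <= triangles e' setT)%N).

Definition in_family (n delta : nat) (e : rel 'I_n) : Prop :=
  family_defined n delta /\ simple_graph e /\
  exists part, family_partition n delta e part.

Definition feasible (n delta : nat) : Prop :=
  family_defined n delta /\
  forall (e : rel 'I_n) part, simple_graph e -> family_partition n delta e part ->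
    triangles e [set x | part x == 0%N] = 0%N.

(* Main.v *)
Require Import Defs.
From HB Require Import structures.
From mathcomp Require Import all_boot all_order all_algebra.
From mathcomp Require Import ring lra zify.
Import Order.TTheory GRing.Theory Num.Theory.
Local Open Scope ring_scope.

(** Write beta = (1 + xi)/(p+1), k_t for the number of t-cliques divided by n^t,
    D(S) for the proportion of vertices adjacent to all of the clique S,
    a_t = 1 - t beta <= D(S), and b_t = (p+1-t) beta = a_t + xi.

    If there is no K_(p+2), every t-clique has a_t <= D(S) <= b_t.  Summing
    (D(S) - a_t)(b_t - D(S)) >= 0 over t-cliques and counting, for each
    (t+1)-clique T, the edges leaving T, gives a linear inequality between k_t,
    k_(t+1) and k_(t+2) which g_t satisfies with equality; a descending induction
    on t yields k_(t+1)/g_(t+1) >= k_t/g_t.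

    In general call an edge bad if D > b_2 + c, a clique bad if it contains a bad
    edge, and replace D(S) by min(D(S), b_t) on bad cliques only.  Every K_(p+2)
    contains a bad edge, so its count is at most a constant times the total
    excess Y_2 of D over b_2 on bad edges.  Truncation produces a gain Y_2/3 in
    k_3/g_3, while all errors are O(c + xi/c) Y_2; hence xi <= c^2 with c small
    suffices.

    In the case of equality Y_2 = 0, so the graph is K_(p+2)-free and regular and
    every p-clique has D = a_p or D = b_p = beta.  In a K_(p+1) at least p-1 of
    the faces have D = beta, and the non-neighbourhoods of the opposite vertices
    are the parts V_1, ..., V_(p-1). *)

(** The bound D(S) <= b_t is a greedy extension argument: a new vertex lowers D by at most beta, so
    D(S) > b_t would leave a (p+1)-clique with D > 0, that is, a K_(p+2). Once K_(p+2) is present,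
    (D - a_t)(b_t - D) may be negative, and cutting D down on every clique would spoil the count of
    edges leaving T whenever a face of T is cut. Good cliques are therefore left alone: all their
    faces are good, so that count stays exact on them. The price is that D may exceed b_t there, but
    the overshoot is multiplied by D - a_t, which is O(xi + c) because every edge of a good clique
    has D <= b_2 + c. Bad edges are cut to b_2 and not to b_2 + c, so each contributes more than c
    to Y_2 and their total weight is at most Y_2/c. The quantity estimated from both sides is the
    mixed product of D and its truncation, not a square: summing D(S) w(S) over t-cliques is the
    same as summing w over the faces of (t+1)-cliques, for any weight w. *)

Set Implicit Arguments.
Unset Strict Implicit.
Unset Printing Implicit Defensive.

(** * Cliques, common neighbourhoods and double counting *)

Section CommonNeighbourhoods.
Variables (n : nat) (e : rel 'I_n).
Hypothesis eG : simple_graph e.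
Implicit Types (S T A : {set 'I_n}) (x y : 'I_n).

Definition nbh x : {set 'I_n} := [set y | e x y].
Definition common S : {set 'I_n} := [set y | S \subset nbh y].
Definition cliques (t : nat) : {set {set 'I_n}} :=
  [set S : {set 'I_n} | (#|S| == t) && is_clique e S].

Lemma adj_irr x : e x x = false. Proof. by case: eG => ir _; exact: ir. Qed.
Lemma adj_sym x y : e x y = e y x. Proof. by case: eG => _ sy; exact: sy. Qed.

Lemma card_nbh x : #|nbh x| = deg e x.
Proof. by []. Qed.

Lemma in_common S y : (y \in common S) = [forall x in S, e x y].
Proof.
rewrite inE; apply/subsetP/forall_inP => H x xS.
  by move: (H x xS); rewrite inE adj_sym.
by rewrite inE adj_sym H.
Qed.

Lemma common_adj S x y : y \in common S -> x \in S -> e x y.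
Proof. by rewrite in_common => /forall_inP; apply. Qed.

Lemma common_notin S x : x \in common S -> x \notin S.
Proof. by move=> xc; apply/negP => /(common_adj xc); rewrite adj_irr. Qed.

Lemma commonS S T : S \subset T -> common T \subset common S.
Proof.
move=> sST; apply/subsetP => y; rewrite !inE; exact: subset_trans.
Qed.

Lemma commonU1 x S : common (x |: S) = nbh x :&: common S.
Proof.
apply/setP => y; rewrite [in RHS]inE !in_common inE.
apply/forall_inP/andP => [H|[exy /forall_inP H] z].
  split; first by apply: H; rewrite setU11.
  by apply/forall_inP => z zS; apply: H; rewrite setU1r.
by case/setU1P => [->|/H].
Qed.

Lemma cliqueP S :
  reflect (forall x y, x \in S -> y \in S -> x != y -> e x y) (is_clique e S).
Proof.
apply: (iffP forall_inP) => [H x y xS yS xy|H x xS].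
  by move: (H x xS) => /forall_inP/(_ y yS)/implyP; apply.
by apply/forall_inP => y yS; apply/implyP; exact: H.
Qed.

Lemma cliqueS S T : S \subset T -> is_clique e T -> is_clique e S.
Proof.
move=> /subsetP sST /cliqueP H; apply/cliqueP => x y xS yS.
by apply: H; exact: sST.
Qed.

Lemma cliqueU1 x S :
  x \notin S -> is_clique e (x |: S) = is_clique e S && (x \in common S).
Proof.
move=> xS; apply/idP/andP => [H|[H xc]].
  split; first exact: cliqueS (subsetUr _ _) H.
  rewrite in_common; apply/forall_inP => y yS.
  move/cliqueP: H; apply; rewrite ?setU11 ?setU1r //.
  by apply: contraNneq xS => <-.
apply/cliqueP => y z; case/setU1P => [->|yS]; case/setU1P => [->|zS].
- by rewrite eqxx.
- by rewrite adj_sym => _; exact: common_adj xc _.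
- by move=> _; exact: common_adj xc _.
- by move/cliqueP: H; apply.
Qed.

Lemma in_cliquesU1 t x S : x \notin S ->
  (x |: S \in cliques t.+1) = (S \in cliques t) && (x \in common S).
Proof. by move=> xS; rewrite !inE cliqueU1 // cardsU1 xS /= eqSS !inE andbA. Qed.

Lemma cliques_card t S : S \in cliques t -> #|S| = t.
Proof. by rewrite inE => /andP[/eqP]. Qed.

Lemma cliques_clique t S : S \in cliques t -> is_clique e S.
Proof. by rewrite inE => /andP[]. Qed.

Lemma cliquesD1 t T x : T \in cliques t.+1 -> x \in T ->
  (T :\ x \in cliques t) /\ x \in common (T :\ x).
Proof.
move=> Tt xT; apply/andP; rewrite -in_cliquesU1 ?setD1K //.
by rewrite !inE eqxx.
Qed.

(** A pair of a clique S and a common neighbour x is the same as a pair of a clique T and a vertex x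
    of T, via T = x |: S. Letting [F] see both T and x allows weights that depend on the face T :\
    x. *)
Lemma double_count t (F : {set 'I_n} -> 'I_n -> rat) :
  \sum_(S in cliques t) \sum_(x in common S) F (x |: S) x =
  \sum_(T in cliques t.+1) \sum_(x in T) F T x.
Proof.
rewrite !pair_big_dep /=.
rewrite (reindex_onto (fun q : {set 'I_n} * 'I_n => (q.1 :\ q.2, q.2))
   (fun q => (q.2 |: q.1, q.2))) /=; last first.
  move=> [S x] /= /andP[_ xc]; congr pair.
  by rewrite setU1K // common_notin.
apply: eq_big => [[T x] /=|[T x] /= /andP[/andP[_ _] /eqP[->]] //].
apply/idP/idP => [/andP[/andP[Tt xc] /eqP[E]]|/andP[Tt xT]]; last first.
  by have [-> ->] := cliquesD1 Tt xT; rewrite setD1K ?eqxx.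
by rewrite -E setU11 in_cliquesU1 ?(common_notin xc) // Tt xc.
Qed.

(** Every density below is computed one vertex y at a time, as a sum over y of a function of this
    single integer. The sum of the integer itself is a degree sum, so linear bounds in [jn] bring in
    the minimum degree. *)
Definition jn S y : nat := #|S :&: nbh y|.

Lemma jn_le S y : (jn S y <= #|S|)%N.
Proof. exact: subset_leq_card (subsetIl _ _). Qed.

Lemma common_jn S y : (y \in common S) = (jn S y == #|S|).
Proof.
rewrite inE; apply/idP/eqP => [/setIidPl|E]; first by rewrite /jn => ->.
apply/setIidPl/eqP; rewrite eqEcard subsetIl /=; by rewrite -E.
Qed.

Lemma sum_jn_in S (U : {set 'I_n}) :
  \sum_(y in U) (jn S y)%:R = \sum_(x in S) #|nbh x :&: U|%:R :> rat.
Proof.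
transitivity (\sum_(y in U) \sum_(x in S) (e x y)%:R : rat).
  apply: eq_bigr => y _; rewrite /jn -sum1_card natr_sum.
  rewrite [RHS](bigID (e^~ y)) /= [X in _ + X]big1 ?addr0; last first.
    by move=> x /andP[_ /negbTE->].
  apply: eq_big => [x|x]; first by rewrite !inE adj_sym.
  by rewrite !inE => /andP[_]; rewrite adj_sym => ->.
rewrite exchange_big /=; apply: eq_bigr => x _.
rewrite -sum1_card natr_sum [RHS]big_mkcond [LHS]big_mkcond /=; apply: eq_bigr => y _.
by rewrite !inE; case: (y \in U); case: (e x y).
Qed.

Lemma sum_jn S : \sum_y (jn S y)%:R = \sum_(x in S) (deg e x)%:R :> rat.
Proof.
transitivity (\sum_(y in [set: 'I_n]) (jn S y)%:R : rat).
  by apply: eq_bigl => y; rewrite inE.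
by rewrite sum_jn_in; apply: eq_bigr => x _; rewrite setIT.
Qed.

Lemma card_set_sum (P : pred 'I_n) : #|[set y | P y]|%:R = \sum_y (P y)%:R :> rat.
Proof.
rewrite -sum1_card natr_sum big_mkcond /=; apply: eq_bigr => y _.
by rewrite inE; case: (P y).
Qed.

Lemma card_common S : #|common S|%:R = \sum_y (jn S y == #|S|)%:R :> rat.
Proof.
rewrite -card_set_sum; congr (_%:R); apply: eq_card => y.
by rewrite common_jn [RHS]inE.
Qed.

Lemma sum_common_pairs S :
  \sum_(A : {set 'I_n} | (A \subset S) && (#|A| == 2%N)) #|common A|%:R =
  \sum_y ('C(jn S y, 2))%:R :> rat.
Proof.
transitivity (\sum_(A : {set 'I_n} | (A \subset S) && (#|A| == 2%N))
   \sum_y (A \subset nbh y)%:R : rat).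
  by apply: eq_bigr => A _; rewrite -card_set_sum.
rewrite exchange_big /=; apply: eq_bigr => y _.
rewrite -cards_draws -sum1_card natr_sum.
rewrite [LHS](bigID (fun A : {set 'I_n} => A \subset nbh y)) /= [X in _ + X]big1 ?addr0; last first.
  by move=> x /andP[_ /negbTE->].
apply: eq_big => [A|A]; first by rewrite !inE subsetI andbAC.
by case/andP => _ ->.
Qed.

Lemma sum_common_faces T :
  \sum_(x in T) #|common (T :\ x)|%:R =
  \sum_y #|[set x in T | T :\ x \subset nbh y]|%:R :> rat.
Proof.
transitivity (\sum_(x in T) \sum_y (T :\ x \subset nbh y)%:R : rat).
  by apply: eq_bigr => x _; rewrite -card_set_sum.
rewrite exchange_big /=; apply: eq_bigr => y _.
rewrite -sum1_card natr_sum [RHS]big_mkcond [LHS]big_mkcond /=.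
apply: eq_bigr => x _; rewrite !inE; case: (x \in T) => //=.
by case: (_ \subset _).
Qed.

(** The vertex y is joined to all faces of T if [jn] is |T|, to one face if it is |T| - 1, and to
    none otherwise. The left side has these two values and is at most 0 below them; it is linear in
    [jn] apart from a multiple of the indicator of full adjacency, so it sums to degrees and
    D(T). *)
Lemma faces_jn T y : (0 < #|T|)%N ->
  (jn T y)%:R + 1 + (#|T|%:R - 2) * (jn T y == #|T|)%:R - (#|T|%:R - 1)
  <= #|[set x in T | T :\ x \subset nbh y]|%:R :> rat.
Proof.
move=> T0; have [E|NE] := eqVneq (jn T y) #|T|.
  rewrite E mulr1; apply: (@le_trans _ _ #|T|%:R); first lra.
  rewrite ler_nat; apply: subset_leq_card; apply/subsetP => x xT; rewrite inE xT /=.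
  move: E => /eqP; rewrite -common_jn inE; apply: subset_trans; exact: subsetDl.
rewrite mulr0 addr0.
have lt : (jn T y < #|T|)%N by rewrite ltn_neqAle NE jn_le.
have [E|NE2] := eqVneq (jn T y).+1 #|T|; last first.
  have : (jn T y).+2%:R <= #|T|%:R :> rat by rewrite ler_nat ltn_neqAle NE2.
  rewrite -addn2 natrD => h; apply: (@le_trans _ _ 0); last by rewrite ler0n.
  lra.
have {1}-> : (jn T y)%:R = #|T|%:R - 1 :> rat by rewrite -E -natr1; lra.
apply: (@le_trans _ _ 1%:R); first lra.
rewrite ler_nat card_gt0; apply/set0Pn.
have C1 : #|T :\: nbh y| = 1%N.
  by move: (cardsID (nbh y) T); rewrite -/(jn T y) -E -addn1 => /addnI.
have /cards1P[x Ex] : #|T :\: nbh y| == 1%N by rewrite C1.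
exists x; rewrite inE; have: x \in T :\: nbh y by rewrite Ex inE.
rewrite inE => /andP[_ xT]; rewrite xT /=.
apply/subsetP => z; rewrite !inE => /andP[zx zT].
have: z \notin T :\: nbh y by rewrite Ex inE.
by rewrite !inE zT andbT negbK.
Qed.

End CommonNeighbourhoods.

Lemma bin2R j : ('C(j, 2))%:R = j%:R * (j%:R - 1) / 2 :> rat.
Proof.
elim: j => [|j IH]; first by rewrite bin0n /=; lra.
by rewrite binS bin1 natrD IH -(natr1 j); lra.
Qed.

Lemma card_supersets (T : finType) (A : {set T}) s :
  (#|[set B : {set T} | (A \subset B) && (#|B| == s)]| <= #|T| ^ (s - #|A|))%N.
Proof.
pose f (B : {set T}) := B :\: A.
have inj : {in [set B : {set T} | (A \subset B) && (#|B| == s)] &, injective f}.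
  move=> B C; rewrite !inE => /andP[AB _] /andP[AC _] E.
  by rewrite -(setID B A) -(setID C A) -/(f B) -/(f C) E (setIidPr AB) (setIidPr AC).
rewrite -(card_in_imset inj).
apply: (@leq_trans #|[set B : {set T} | #|B| == (s - #|A|)%N]|).
  apply: subset_leq_card; apply/subsetP => _ /imsetP[B + ->].
  rewrite !inE => /andP[AB /eqP <-].
  by rewrite /f cardsD (setIidPr AB).
rewrite card_draws; elim: (s - #|A|)%N => [|k IH]; first by rewrite bin0.
have := mul_bin_left #|T| k => E.
apply: (@leq_trans (k.+1 * 'C(#|T|, k.+1))%N); first by rewrite leq_pmull.
by rewrite E expnS leq_mul // leq_subr.
Qed.

(** * Normalised averages over cliques and density bounds from the minimum degree *)

Section Normalized.
Variables (n : nat) (e : rel 'I_n) (beta : rat).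
Hypotheses (eG : simple_graph e) (n0 : (0 < n)%N).
Hypothesis degG : forall x, (1 - beta) * n%:R <= (deg e x)%:R.
Implicit Types (S T A : {set 'I_n}) (x y : 'I_n) (F G w : {set 'I_n} -> rat).

Local Notation common := (common e).
Local Notation cliques := (cliques e).
Local Notation N := (n%:R : rat).

Definition density S : rat := #|common S|%:R / N.
Definition clique_avg (t : nat) F : rat := (\sum_(S in cliques t) F S) / N ^+ t.
Definition clique_density (t : nat) : rat := #|cliques t|%:R / N ^+ t.

Lemma N_gt0 : 0 < N. Proof. by rewrite ltr0n. Qed.
Lemma N_neq0 : N != 0. Proof. by rewrite gt_eqF ?N_gt0. Qed.
Lemma NX_gt0 t : 0 < N ^+ t. Proof. by rewrite exprn_gt0 ?N_gt0. Qed.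

Lemma dens_ge0 S : 0 <= density S.
Proof. by rewrite divr_ge0 ?ler0n. Qed.

Lemma dens_le1 S : density S <= 1.
Proof.
rewrite ler_pdivrMr ?N_gt0 // mul1r ler_nat.
by rewrite (leq_trans (max_card _)) // card_ord.
Qed.

Lemma avg_le t F G :
  (forall S, S \in cliques t -> F S <= G S) -> clique_avg t F <= clique_avg t G.
Proof.
move=> H; rewrite ler_wpM2r ?invr_ge0 ?(ltW (NX_gt0 t)) //; exact: ler_sum.
Qed.

Lemma eq_avg t F G :
  (forall S, S \in cliques t -> F S = G S) -> clique_avg t F = clique_avg t G.
Proof. by move=> H; congr (_ / _); exact: eq_bigr. Qed.

Lemma avgD t F G : clique_avg t (fun S => F S + G S) = clique_avg t F + clique_avg t G.
Proof. by rewrite /clique_avg big_split mulrDl. Qed.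

Lemma avgZ t k F : clique_avg t (fun S => k * F S) = k * clique_avg t F.
Proof. by rewrite /clique_avg -mulr_sumr mulrA. Qed.

Lemma avgN t F : clique_avg t (fun S => - F S) = - clique_avg t F.
Proof. by rewrite /clique_avg sumrN mulNr. Qed.

Lemma avgC t k : clique_avg t (fun=> k) = k * clique_density t.
Proof. by rewrite /clique_avg /clique_density sumr_const -(mulr_natr k) mulrA. Qed.

Lemma avg_ge0 t F : (forall S, S \in cliques t -> 0 <= F S) -> 0 <= clique_avg t F.
Proof. by move=> H; have := avg_le H; rewrite avgC mul0r. Qed.

Lemma avg_eq0 t F : (forall S, S \in cliques t -> 0 <= F S) ->
  clique_avg t F = 0 -> forall S, S \in cliques t -> F S = 0.
Proof.
move=> H; rewrite /clique_avg => /eqP; rewrite mulf_eq0 invr_eq0 (gt_eqF (NX_gt0 t)) orbF.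
move=> /eqP /psumr_eq0P E S St; exact: E.
Qed.

Lemma kap_ge0 t : 0 <= clique_density t.
Proof. by rewrite divr_ge0 ?ler0n ?(ltW (NX_gt0 t)). Qed.

Lemma avg_ext t (F : {set 'I_n} -> 'I_n -> rat) :
  clique_avg t (fun S => (\sum_(x in common S) F (x |: S) x) / N) =
  clique_avg t.+1 (fun T => \sum_(x in T) F T x).
Proof.
rewrite /clique_avg -mulr_suml -(double_count eG) exprSr invfM mulrA.
by rewrite mulrAC.
Qed.

(** The factor [density S] chooses a vertex extending S, and S is then the face opposite to it. This
    is the only passage between consecutive levels: w = 1 counts (t+1)-cliques, w = truncated
    density relates levels t and t+1. *)
Lemma avg_densM t w : clique_avg t (fun S => density S * w S) =
  clique_avg t.+1 (fun T => \sum_(x in T) w (T :\ x)).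
Proof.
rewrite -avg_ext; apply: eq_avg => S St.
rewrite (eq_bigr (fun=> w S)) => [|x xc]; last by rewrite setU1K ?(common_notin eG).
by rewrite sumr_const -(mulr_natr (w S)) /density; ring.
Qed.

Lemma avg_dens t : clique_avg t density = t.+1%:R * clique_density t.+1.
Proof.
transitivity (clique_avg t (fun S => density S * 1)); first by apply: eq_avg => S _; rewrite mulr1.
rewrite avg_densM -avgC; apply: eq_avg => T Tt.
by rewrite sumr_const (cliques_card Tt).
Qed.

Lemma kap1 : clique_density 1 = 1.
Proof.
rewrite /clique_density; have -> : #|cliques 1| = n.
  rewrite -[RHS](card_ord n) -[RHS]bin1 -card_draws; apply: eq_card => S.
  rewrite !inE; case: eqP => //= /eqP/cards1P[x ->].
  by apply/cliqueP => y z; rewrite !inE => /eqP-> /eqP->; rewrite eqxx.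
by rewrite expr1 divff // N_neq0.
Qed.

Lemma sum_deg_ge S : #|S|%:R * (1 - beta) * N <= \sum_(x in S) (deg e x)%:R.
Proof.
rewrite -mulrA mulr_natl -sumr_const; apply: ler_sum => x _; exact: degG.
Qed.

Lemma dens_ge S : 1 - #|S|%:R * beta <= density S.
Proof.
rewrite ler_pdivlMr ?N_gt0 // card_common //.
apply: (@le_trans _ _ (\sum_y ((jn e S y)%:R + (1 - #|S|%:R)))).
  rewrite big_split /= (sum_jn eG) sumr_const card_ord -(mulr_natr (1 - _)).
  have := sum_deg_ge S; lra.
apply: ler_sum => y _; have := jn_le e S y.
have [->|NE lt] := eqVneq (jn e S y) #|S|; first by move=> _ /=; lra.
have : (jn e S y).+1%:R <= #|S|%:R :> rat by rewrite ler_nat ltn_neqAle NE.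
by rewrite -(natr1 (jn e S y)) => h; rewrite /=; lra.
Qed.

Lemma sum_dens_faces T : (0 < #|T|)%N ->
  2 - #|T|%:R * beta + (#|T|%:R - 2) * density T <= \sum_(x in T) density (T :\ x).
Proof.
move=> T0; rewrite -mulr_suml ler_pdivlMr ?N_gt0 // sum_common_faces //.
have -> : (2 - #|T|%:R * beta + (#|T|%:R - 2) * density T) * N =
  (2 - #|T|%:R * beta) * N + (#|T|%:R - 2) * #|common T|%:R.
  by rewrite /density; field; exact: N_neq0.
apply: (@le_trans _ _ (\sum_y ((jn e T y)%:R + (1 + (#|T|%:R - 2) *
   (jn e T y == #|T|)%:R - (#|T|%:R - 1))))); last first.
  by apply: ler_sum => y _; have := @faces_jn n e T y T0; lra.
rewrite big_split /= (sum_jn eG) !big_split /= -mulr_sumr -card_common //.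
rewrite !sumr_const !card_ord -(mulr_natr 1) -(mulr_natr (- _)).
have := sum_deg_ge T; lra.
Qed.

Lemma dens_pairs_ge S q :
  q%:R * #|S|%:R * (1 - beta) - q%:R * (q%:R + 1) / 2 <=
  \sum_(A : {set 'I_n} | (A \subset S) && (#|A| == 2%N)) density A.
Proof.
rewrite -mulr_suml ler_pdivlMr ?N_gt0 // sum_common_pairs.
apply: (@le_trans _ _ (\sum_y (q%:R * (jn e S y)%:R - q%:R * (q%:R + 1) / 2))).
  rewrite big_split /= -mulr_sumr (sum_jn eG) sumr_const card_ord -(mulr_natr (- _)).
  have h := ler_wpM2l (ler0n rat q) (sum_deg_ge S).
  by apply: le_trans (lerD h (lexx _)); rewrite mulNr mulrBl !mulrA.
apply: ler_sum => y _; rewrite bin2R.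
(* integrality: [(j - q) (j - q - 1) >= 0] *)
have : 0 <= ((jn e S y)%:R - q%:R) * ((jn e S y)%:R - q%:R - 1) :> rat.
  have [h|h] := leqP (jn e S y) q.
    have : (jn e S y)%:R <= q%:R :> rat by rewrite ler_nat.
    by move=> h2; apply: mulr_le0; lra.
  have : q.+1%:R <= (jn e S y)%:R :> rat by rewrite ler_nat.
  by rewrite -(natr1 q) => h2; apply: mulr_ge0; lra.
lra.
Qed.

(** If y misses i vertices of S, the indicator of i = 0 is at most (i - 1)(i - 2)/2, with equality
    for i = 0, 1, 2. Expanded in [jn], this is a constant, a negative multiple of [jn], controlled
    by the minimum degree, and 'C(jn, 2), which sums to the densities of the pairs in S. *)
Lemma dens_le_pairs S M : (2 <= #|S|)%N ->
  (forall A, A \subset S -> #|A| = 2%N -> density A <= M) ->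
  density S <= (#|S|%:R - 1) * (#|S|%:R - 2) / 2
    - (#|S|%:R - 2) * #|S|%:R * (1 - beta) + #|S|%:R * (#|S|%:R - 1) / 2 * M.
Proof.
move=> S2 HM; set s := #|S|%:R.
have s2 : 2 <= s by rewrite ler_nat.
have h1 : \sum_(A : {set 'I_n} | (A \subset S) && (#|A| == 2%N)) density A
    <= s * (s - 1) / 2 * M.
  rewrite -bin2R -cards_draws mulr_natl -sumr_const big_set /=.
  by apply: ler_sum => A /andP[AS /eqP A2]; exact: HM.
apply: le_trans (lerD (lexx _) h1).
rewrite -mulr_suml ler_pdivrMr ?N_gt0 // sum_common_pairs card_common //.
apply: (@le_trans _ _ (\sum_y ((s - 1) * (s - 2) / 2 -
   (s - 2) * (jn e S y)%:R + ('C(jn e S y, 2))%:R))).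
  apply: ler_sum => y _; rewrite bin2R.
  have [->|NE] := eqVneq (jn e S y) #|S|; first by rewrite -/s /=; lra.
  have lt : (jn e S y < #|S|)%N by rewrite ltn_neqAle NE jn_le.
  have: (jn e S y).+1%:R <= s by rewrite ler_nat.
  rewrite -(natr1 (jn e S y)) /= => h.
  have : 0 <= (s - 1 - (jn e S y)%:R) * (s - 2 - (jn e S y)%:R).
    have [lt2|] := ltnP (jn e S y).+1 #|S|.
      have: (jn e S y).+2%:R <= s by rewrite ler_nat.
      by rewrite -addn2 natrD => h2; apply: mulr_ge0; lra.
    rewrite -(ler_nat rat) -(natr1 (jn e S y)) -/s => h2; have -> : s - 1 - (jn e S y)%:R = 0 by lra.
    by rewrite mul0r.
  lra.
rewrite !big_split /= sumrN sumr_const card_ord -mulr_sumr (sum_jn eG) -(mulr_natr (_ / 2)).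
have h : 0 <= (s - 2) * (\sum_(x in S) (deg e x)%:R - s * (1 - beta) * N).
  by rewrite mulr_ge0 ?subr_ge0 // sum_deg_ge.
rewrite [X in _ <= X]mulrDl divfK ?N_neq0 //; nra.
Qed.

End Normalized.

(** * Truncated densities and the inequality between three consecutive clique densities *)

Section Truncation.
Variables (n : nat) (e : rel 'I_n) (beta : rat).
Hypotheses (eG : simple_graph e) (n0 : (0 < n)%N).
Hypothesis degG : forall x, (1 - beta) * n%:R <= (deg e x)%:R.
Variables (p : nat) (c : rat).
Implicit Types (S T A : {set 'I_n}) (x y : 'I_n) (F G : {set 'I_n} -> rat).

Local Notation common := (common e).
Local Notation cliques := (cliques e).
Local Notation N := (n%:R : rat).
Local Notation dens := (density e).
Local Notation avg := (clique_avg e).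
Local Notation kap := (clique_density e).
Local Notation P := (p.+1%:R : rat).

Definition low_density (t : nat) : rat := 1 - t%:R * beta.
Definition high_density (t : nat) : rat := (P - t%:R) * beta.
Definition density_gap : rat := P * beta - 1.

Hypotheses (c0 : 0 < c) (xi0 : 0 <= density_gap).

Lemma beta_ge : P^-1 <= beta.
Proof.
have P0 : 0 < P by rewrite ltr0n.
rewrite -[P^-1]mul1r ler_pdivrMr //; move: xi0; rewrite /density_gap; lra.
Qed.

Lemma beta_gt0 : 0 < beta.
Proof. by apply: lt_le_trans beta_ge; rewrite invr_gt0 ltr0n. Qed.

Lemma bcE t : high_density t = low_density t + density_gap.
Proof. by rewrite /high_density /low_density /density_gap; ring. Qed.

Lemma bcS t : high_density t.+1 = high_density t - beta.
Proof. by rewrite /high_density -(natr1 t); ring. Qed.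

Definition bad_edge A := (A \in cliques 2) && (high_density 2 + c < dens A).
Definition bad S := [exists A : {set 'I_n}, (A \subset S) && bad_edge A].
Definition trunc S := if bad S then Num.min (dens S) (high_density #|S|) else dens S.
Definition excess t : rat := avg t (fun S => dens S - trunc S).
(* Summed over all cliques, unlike [excess]; both are controlled by the number of [K_(p+2)]. *)
Definition overflow t : rat := avg t (fun S => Num.max 0 (dens S - high_density t)).
Definition bad_weight : rat := avg 2 (fun A => (bad_edge A)%:R).

Lemma badS S T : S \subset T -> bad S -> bad T.
Proof.
move=> ST /existsP[A /andP[AS bA]]; apply/existsP; exists A.
by rewrite (subset_trans AS ST).
Qed.

Lemma bad_cliques2 A : A \in cliques 2 -> bad A = bad_edge A.
Proof.
move=> A2; apply/idP/idP => [/existsP[B /andP[BA bB]]|bA]; last first.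
  by apply/existsP; exists A; rewrite subxx.
suff <- : B = A by [].
apply/eqP; rewrite eqEcard BA (cliques_card A2).
by case/andP: bB => /cliques_card ->.
Qed.

Lemma trunc_le S : trunc S <= dens S.
Proof. by rewrite /trunc; case: ifP => // _; rewrite ge_min lexx. Qed.

Lemma trunc_ge S : low_density #|S| <= trunc S.
Proof.
rewrite /trunc; have := dens_ge eG n0 degG S; rewrite -/(low_density _) => h.
case: ifP => // _; rewrite le_min h bcE; move: xi0; lra.
Qed.

(** Up to size p + 1 the level b_t is nonnegative, so the part cut off is at most D <= 1. *)
Lemma excess_bad S : (#|S| <= p.+1)%N -> dens S - trunc S <= (bad S)%:R.
Proof.
move=> Sp; rewrite /trunc; case: ifP => _ /=; last by rewrite subrr.
have := dens_le1 e n0 S.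
have : 0 <= high_density #|S|.
  by rewrite mulr_ge0 ?(ltW beta_gt0) // subr_ge0 ler_nat.
have := dens_ge0 e S.
by rewrite minEle; case: ifP => ?; lra.
Qed.

Lemma excess_ge0 t : 0 <= excess t.
Proof. by apply: avg_ge0 => // S _; rewrite subr_ge0 trunc_le. Qed.

Lemma avg_trunc t : avg t trunc = t.+1%:R * kap t.+1 - excess t.
Proof.
rewrite -(avg_dens eG) /excess avgD avgN; ring.
Qed.

(** An edge lies in at most n^(t-2) cliques of size t, which is the ratio of the two
    normalisations. *)
Lemma avg_pairs_le t F : (2 <= t)%N -> (forall A, 0 <= F A) ->
  avg t (fun S => \sum_(A : {set 'I_n} | (A \subset S) && (#|A| == 2%N)) F A)
  <= avg 2 F.
Proof.
move=> t2 F0.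
suff H : \sum_(S in cliques t)
   \sum_(A : {set 'I_n} | (A \subset S) && (#|A| == 2%N)) F A <=
   (\sum_(A in cliques 2) F A) * N ^+ (t - 2).
  rewrite ler_pdivrMr ?NX_gt0 //; apply: le_trans H _.
  rewrite -{2}(subnKC t2) exprD /avg mulrA divfK // ?expf_neq0 ?N_neq0 //.
rewrite (exchange_big_dep (mem (cliques 2))) /=; last first.
  move=> S A St /andP[AS A2]; rewrite inE A2.
  by apply: cliqueS AS _; exact: cliques_clique St.
rewrite mulr_suml; apply: ler_sum => A A2.
rewrite sumr_const -(mulr_natr (F A)) ler_wpM2l // -natrX ler_nat.
have := card_supersets A t; rewrite card_ord (cliques_card A2).
apply: leq_trans; apply: subset_leq_card.
apply/subsetP => S; rewrite !inE unfold_in => /and3P[St -> _].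
by rewrite (cliques_card St) eqxx.
Qed.

Lemma avg_bad_le t : (2 <= t)%N -> avg t (fun S => (bad S)%:R) <= bad_weight.
Proof.
move=> t2; apply: le_trans (avg_pairs_le (F := fun A => (bad_edge A)%:R) t2 _) => //.
apply: avg_le => // S St; case: (boolP (bad S)) => [/existsP[A /andP[AS bA]]|_].
  have A2 : #|A| == 2%N by case/andP: bA => /cliques_card ->.
  by rewrite (bigD1 A) ?AS //= bA lerDl; apply: sumr_ge0.
by apply: sumr_ge0.
Qed.

Lemma excess_le t : (2 <= t <= p.+1)%N -> excess t <= bad_weight.
Proof.
case/andP => t2 tp; apply: le_trans (avg_bad_le t2).
by apply: avg_le => // S St; apply: excess_bad; rewrite (cliques_card St).
Qed.

Lemma excess2_bad A : A \in cliques 2 -> dens A - high_density 2 - c <= dens A - trunc A.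
Proof.
move=> A2; rewrite /trunc (bad_cliques2 A2) /bad_edge A2 (cliques_card A2) /=.
have c0' := c0.
by rewrite minEle; case: (ltP (high_density 2 + c) (dens A)) => h; first case: ifP => ?; lra.
Qed.

Lemma bad_weight_le : c * bad_weight <= excess 2.
Proof.
rewrite -avgZ; apply: avg_le => // A A2; case: (boolP (bad_edge A)) => bA; last first.
  by rewrite mulr0 subr_ge0 trunc_le.
rewrite mulr1 /trunc (bad_cliques2 A2) bA (cliques_card A2).
case/andP: bA => _; have c0' := c0.
by rewrite minEle; case: ifP => ?; lra.
Qed.

Lemma dens_drop T x : x \in T -> dens (T :\ x) - beta <= dens T.
Proof.
move=> xT; have E : common T = nbh e x :&: common (T :\ x).
  by rewrite -commonU1 // setD1K.
rewrite /density E; set U := common (T :\ x).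
have : #|U|%:R <= #|nbh e x :&: U|%:R + (N - (deg e x)%:R).
  rewrite -(cardsID (nbh e x) U) natrD setIC lerD2l.
  have := cardsC (nbh e x); rewrite card_ord card_nbh => En.
  have -> : N - (deg e x)%:R = #|~: nbh e x|%:R.
    by rewrite -{1}En natrD addrC addKr.
  rewrite ler_nat.
  by apply: subset_leq_card; rewrite setDE subsetIr.
have := degG x => h1 h2.
have -> : #|U|%:R / N - beta = (#|U|%:R - beta * N) / N.
  by field; rewrite N_neq0.
by rewrite ler_wpM2r ?invr_ge0 ?ler0n //; lra.
Qed.

(* Greedy extension: if [D(S) > b_t], every extension [T] of [S] has [D(T) - b_(t+1) >= D(S) - b_t]. *)
Lemma overflow_step t : (t <= p)%N ->
  high_density t * overflow t <= t.+1%:R * overflow t.+1.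
Proof.
move=> tp; rewrite -!avgZ.
apply: (@le_trans _ _ (avg t (fun S => dens S * Num.max 0 (dens S - high_density t)))).
  apply: avg_le => // S _; rewrite maxEle; case: ifP => h; last by rewrite !mulr0.
  by apply: ler_wpM2r => //; lra.
rewrite (avg_densM eG); apply: avg_le => // T Tt.
rewrite -(cliques_card Tt) mulr_natl -sumr_const; apply: ler_sum => x xT.
rewrite (cliques_card Tt) bcS; have := dens_drop xT.
by rewrite !maxEle; case: ifP => h1; case: ifP => h2 h3; lra.
Qed.

(** Since b_(p+1) = 0, the whole density of a (p+1)-clique is overflow. *)
Lemma overflow_last : overflow p.+1 = p.+2%:R * kap p.+2.
Proof.
rewrite -(avg_dens eG); apply: eq_avg => S _.
by rewrite /high_density subrr mul0r subr0; apply/max_idPr; exact: dens_ge0.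
Qed.

(** Each use of [overflow_step] costs a factor (t+1)/b_t <= P * P, because b_t >= beta >= 1/P. At
    most p + 1 uses lead to [overflow_last], which contributes p + 2. *)
Definition Cov : rat := (P ^+ 2) ^+ p.+1 * p.+2%:R.

Lemma P_ge1 : 1 <= P. Proof. by rewrite ler1n. Qed.

Lemma overflow_le t : (t <= p.+1)%N -> overflow t <= Cov * kap p.+2.
Proof.
move=> tp; suff H j : (j <= p.+1)%N ->
    overflow (p.+1 - j) <= (P ^+ 2) ^+ j * p.+2%:R * kap p.+2.
  rewrite -(subKn tp); apply: le_trans (H _ (leq_subr _ _)) _.
  rewrite /Cov -!mulrA; apply: ler_wpM2r; first by rewrite mulr_ge0 ?kap_ge0.
  by apply: ler_weXn2l; rewrite ?leq_subr // exprn_ege1 // P_ge1.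
elim: j => [|j IH] jp; first by rewrite subn0 overflow_last expr0 mul1r.
have {IH} := IH (ltnW jp).
set s := (p.+1 - j.+1)%N; have sE : (p.+1 - j)%N = s.+1 by rewrite /s; lia.
have sp : (s <= p)%N by rewrite /s; lia.
rewrite sE -!mulrA => IH.
have o0 k : 0 <= overflow k by apply: avg_ge0 => // S _; rewrite le_max lexx.
have h1 := overflow_step sp.
have h2 : P^-1 <= high_density s.
  apply: le_trans beta_ge _; rewrite /high_density ler_peMl ?(ltW beta_gt0) //.
  by rewrite lerBrDl -(natr1 p) lerD2r ler_nat.
have h3 : s.+1%:R <= P by rewrite ler_nat.
have h4 : P^-1 * overflow s <= P * overflow s.+1.
  apply: le_trans (le_trans h1 _); first exact: ler_wpM2r.
  exact: ler_wpM2r.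
have P0 : 0 < P by rewrite ltr0n.
have h5 : overflow s <= P * (P * overflow s.+1).
  by move: h4; rewrite mulrC ler_pdivrMr // [_ * P]mulrC.
by apply: le_trans h5 _; rewrite [_ ^+ j.+1]exprS expr2 -!mulrA !ler_pM2l.
Qed.

Hypothesis c_small : c * (4 * p.+2%:R ^+ 3) <= 1.
Hypothesis xi_c : density_gap <= c ^+ 2.

Lemma c_le1 : c <= 1.
Proof.
have h : 1 <= p.+2%:R ^+ 3 :> rat by rewrite exprn_ege1 // ler1n.
have := c_small; have c0' := c0; nra.
Qed.

Lemma xi_le_c : density_gap <= c.
Proof.
by apply: le_trans xi_c _; rewrite expr2 ler_piMl ?c_le1 // ltW.
Qed.

Lemma betaE : beta = (1 + density_gap) / P.
Proof. by rewrite /density_gap; field; rewrite nat1r pnatr_eq0. Qed.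

(** [dens_pairs_ge] is tuned by taking its integer parameter to be p: at xi = c = 0 it bounds the
    sum of D - b_2 over the edges of Q below by 1/P. Half of this is kept. After multiplication by
    2P the terms in xi and c are each at most c (p+2)^3, hence at most 1/4 by [c_small], and the
    other half absorbs them. *)
Lemma big_clique_excess Q : Q \in cliques p.+2 -> (2 * P)^-1 <=
  \sum_(A : {set 'I_n} | (A \subset Q) && (#|A| == 2%N)) (dens A - trunc A).
Proof.
move=> Qp.
apply: (@le_trans _ _ (\sum_(A : {set 'I_n} | (A \subset Q) && (#|A| == 2%N))
   (dens A + (- high_density 2 - c)))); last first.
  apply: ler_sum => A /andP[AQ A2]; rewrite addrA; apply: excess2_bad.
  by rewrite inE A2; apply: cliqueS AQ _; exact: cliques_clique Qp.
rewrite big_split /=.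
have -> : \sum_(A : {set 'I_n} | (A \subset Q) && (#|A| == 2%N)) (- high_density 2 - c) =
   (p.+2%:R * (p.+2%:R - 1) / 2) * (- high_density 2 - c).
  rewrite -bin2R -(cliques_card Qp) -cards_draws mulr_natl -sumr_const big_set.
  by [].
have := dens_pairs_ge eG n0 degG Q p; rewrite (cliques_card Qp) => h.
apply: le_trans (lerD h (lexx _)).
rewrite /high_density betaE -(natr1 p.+1) -(natr1 p).
have h1 := xi_le_c; have h2 := c_small; have h3 := xi0; have h4 := c0.
have q0 : 0 <= p%:R :> rat by exact: ler0n.
move: h2; rewrite -(natr1 p.+1) -(natr1 p).
set q := p%:R in q0 *; move=> h2.
have q1 : q + 1 != 0 by lra.
rewrite -subr_ge0.
have -> : q * (q + 1 + 1) * (1 - (1 + density_gap) / (q + 1)) - q * (q + 1) / 2 +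
   (q + 1 + 1) * (q + 1 + 1 - 1) / 2 *
   (- ((q + 1 - 2) * ((1 + density_gap) / (q + 1))) - c) - (2 * (q + 1))^-1 =
   (1 - density_gap * (q + 2) * (q ^+ 2 + 2 * q - 1) - c * (q + 2) * (q + 1) ^+ 2)
    / (2 * (q + 1)) by field; lra.
apply: mulr_ge0; last by rewrite invr_ge0; lra.
have k1 : density_gap * (q + 2) * (q ^+ 2 + 2 * q - 1) <= c * (q + 2) ^+ 3.
  apply: (@le_trans _ _ (density_gap * (q + 2) ^+ 3)); last by apply: ler_wpM2r => //; apply: exprn_ge0; lra.
  rewrite -mulrA; apply: ler_wpM2l => //; nra.
have k2 : c * (q + 2) * (q + 1) ^+ 2 <= c * (q + 2) ^+ 3.
  rewrite -mulrA; apply: ler_wpM2l; first exact: ltW.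
  nra.
have e2 : q + 1 + 1 = q + 2 by ring.
move: h2; rewrite e2; have : 0 <= c * (q + 2) ^+ 3 by apply: mulr_ge0; [exact: ltW|apply: exprn_ge0; lra].
lra.
Qed.

Lemma kap_big_le : kap p.+2 <= 2 * P * excess 2.
Proof.
have h := @avg_pairs_le p.+2 (fun A => dens A - trunc A) isT _.
have {}h := h (fun A => _); have {h} := h (fun A => etrans (subr_ge0 _ _) (trunc_le A)).
rewrite -/(excess 2) => h.
have h1 : (2 * P)^-1 * kap p.+2 <= excess 2.
  apply: le_trans h; rewrite -avgC; apply: avg_le => // Q; exact: big_clique_excess.
have P0 : 0 < 2 * P by rewrite mulr_gt0 // ltr0n.
by move: h1; rewrite mulrC ler_pdivrMr // mulrC.
Qed.

(** This is [dens_le_pairs] with M = b_2 + c; with M = a_2 it would give exactly a_t, and M exceeds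
    a_2 by xi + c on each of the t(t-1)/2 pairs. *)
Lemma good_dens_le S t : S \in cliques t -> (2 <= t)%N -> ~~ bad S ->
  dens S <= low_density t + t%:R * (t%:R - 1) / 2 * (density_gap + c).
Proof.
move=> St t2 gS; have := @dens_le_pairs n e beta eG n0 degG S (high_density 2 + c).
rewrite (cliques_card St) => /(_ t2) h.
have {}h : dens S <= (t%:R - 1) * (t%:R - 2) / 2 - (t%:R - 2) * t%:R * (1 - beta) +
      t%:R * (t%:R - 1) / 2 * (high_density 2 + c).
  apply: h => A AS A2; rewrite leNgt; apply: contra gS => hA.
  apply/existsP; exists A; rewrite AS /bad_edge hA inE A2 eqxx !andbT /=.
  by apply: cliqueS AS _; exact: cliques_clique St.
apply: le_trans h _; rewrite bcE /low_density; lra.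
Qed.

(** For D <= b_t nothing is cut and this is (D - a_t)(b_t - D) >= 0. For a bad clique with D > b_t
    the truncated value is b_t and the main terms agree. A good clique with D > b_t has a defect (D
    - a_t)(D - b_t), and [good_dens_le] bounds its first factor. *)
Lemma upper_pointwise S t : S \in cliques t -> (2 <= t)%N ->
  dens S * trunc S <= high_density t * dens S + low_density t * trunc S - low_density t * high_density t +
    t%:R * (t%:R - 1) / 2 * (density_gap + c) * Num.max 0 (dens S - high_density t).
Proof.
move=> St t2.
have tt : 0 <= t%:R * (t%:R - 1) / 2 :> rat by rewrite -bin2R ler0n.
have m0 : 0 <= Num.max 0 (dens S - high_density t) by rewrite le_max lexx.
have x0 : 0 <= density_gap + c by apply: addr_ge0 => //; exact: ltW.
have r0 : 0 <= t%:R * (t%:R - 1) / 2 * (density_gap + c) * Num.max 0 (dens S - high_density t).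
  by apply: mulr_ge0 => //; apply: mulr_ge0.
have dge := dens_ge eG n0 degG S; rewrite (cliques_card St) -/(low_density t) in dge.
have bE := bcE t; have X0 := xi0.
have small : dens S <= high_density t ->
  dens S * dens S <= high_density t * dens S + low_density t * dens S - low_density t * high_density t.
  move=> h; have : 0 <= (dens S - low_density t) * (high_density t - dens S) by apply: mulr_ge0; lra.
  lra.
rewrite /trunc (cliques_card St); case: (boolP (bad S)) => [bS|gS].
  apply: ler_wpDr => //; rewrite minEle; case: ifP => [|h]; first exact: small.
  lra.
case: (leP (dens S) (high_density t)) => h; first by apply: ler_wpDr => //; exact: small.
have -> : Num.max 0 (dens S - high_density t) = dens S - high_density t by apply/max_idPr; lra.
have := good_dens_le St t2 gS => h2.
have : 0 <= (low_density t + t%:R * (t%:R - 1) / 2 * (density_gap + c) - dens S) * (dens S - high_density t).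
  by apply: mulr_ge0; lra.
lra.
Qed.

(** No face of a good T is cut, so [sum_dens_faces] applies unchanged. For a bad T each face is only
    known to be at least a_t; together with [trunc T] <= b_(t+1) this falls short by exactly (t - 1)
    xi, the term subtracted on the left. *)
Lemma lower_pointwise T t : T \in cliques t.+1 -> (1 <= t)%N ->
  2 - t.+1%:R * beta + (t%:R - 1) * trunc T - (t%:R - 1) * density_gap * (bad T)%:R <=
  \sum_(x in T) trunc (T :\ x).
Proof.
move=> Tt t1; have cT := cliques_card Tt.
have t1' : 0 <= t%:R - 1 :> rat by rewrite subr_ge0 ler1n.
case: (boolP (bad T)) => [bT|gT].
  apply: (@le_trans _ _ (t.+1%:R * low_density t)).
    have : trunc T <= high_density t.+1 by rewrite /trunc bT cT ge_min lexx orbT.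
    move=> /(ler_wpM2l t1'); rewrite /high_density /low_density /density_gap -(natr1 t) -(natr1 p) /=; lra.
  rewrite -cT mulr_natl -sumr_const; apply: ler_sum => x xT.
  have [S1 _] := cliquesD1 eG Tt xT.
  by rewrite -(cliques_card S1) trunc_ge.
rewrite mulr0 subr0 [X in _ <= X](eq_bigr (fun x => dens (T :\ x))); last first.
  move=> x xT; rewrite /trunc ifN //; apply: contra gT; apply: badS; exact: subsetDl.
rewrite /trunc (negbTE gT); have := sum_dens_faces eG n0 degG (T := T).
by rewrite cT => /(_ isT); rewrite -(natr1 t); lra.
Qed.

(** The average of D times its truncation over t-cliques is bounded above by [upper_pointwise] and,
    after [avg_densM], below by [lower_pointwise]. *)
Lemma clique_ineq t : (2 <= t)%N ->
  low_density t * high_density t * kap t + (t%:R - 1) * (t.+2%:R * kap t.+2 - excess t.+1)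
    + low_density t * excess t <=
  ((low_density t + high_density t) * t.+1%:R - 2 + t.+1%:R * beta) * kap t.+1
    + t%:R * (t%:R - 1) / 2 * (density_gap + c) * overflow t + (t%:R - 1) * density_gap * bad_weight.
Proof.
move=> t2.
have h1 : avg t (fun S => dens S * trunc S) <=
   high_density t * (t.+1%:R * kap t.+1) + low_density t * (t.+1%:R * kap t.+1 - excess t) - low_density t * high_density t * kap t
   + t%:R * (t%:R - 1) / 2 * (density_gap + c) * overflow t.
  rewrite -avg_trunc -(avg_dens eG) -!avgZ -avgC -avgN -!avgD.
  by apply: avg_le => // S St; apply: upper_pointwise.
have h2 : (2 - t.+1%:R * beta) * kap t.+1 + (t%:R - 1) * (t.+2%:R * kap t.+2 - excess t.+1)
   - (t%:R - 1) * density_gap * avg t.+1 (fun T => (bad T)%:R) <= avg t (fun S => dens S * trunc S).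
  rewrite (avg_densM eG) -avg_trunc -!avgZ -avgC -avgN -!avgD.
  by apply: avg_le => // T Tt; apply: lower_pointwise => //; exact: ltnW.
have h3 : (t%:R - 1) * density_gap * avg t.+1 (fun T => (bad T)%:R) <= (t%:R - 1) * density_gap * bad_weight.
  apply: ler_wpM2l; last exact: avg_bad_le (ltnW _).
  by rewrite mulr_ge0 // subr_ge0 ler1n ltnW.
lra.
Qed.

End Truncation.

(** * The extremal densities g_t, their recursions and bounds, and the constants of the descent *)

Section ExtremalDensity.
Variables (q : nat) (beta : rat).

(* [g r beta] when [pof beta = q.+1]; [hp] is its last summand, which counts the
   cliques with two vertices in [V_0]. *)
Definition gp (r : nat) : rat :=
  binz q r%:Z * beta ^+ r
  + binz q (r%:Z - 1) * (1 - q%:R * beta) * beta ^+ r.-1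
  + 2^-1 * binz q (r%:Z - 2) * (1 - q.+1%:R * beta) * (1 - q%:R * beta)
      * beta ^+ r.-2.

Definition hp (t : nat) : rat :=
  2^-1 * ('C(q, t - 2))%:R * (1 - q.+1%:R * beta) * (1 - q%:R * beta)
    * beta ^+ (t - 2).

Lemma gpE k : gp k.+2 = ('C(q, k.+2))%:R * beta ^+ k.+2
  + ('C(q, k.+1))%:R * (1 - q%:R * beta) * beta ^+ k.+1 + hp k.+2.
Proof.
rewrite /gp /hp subn2.
have -> : k.+2%:Z - 1 = k.+1%:Z by rewrite -[k.+2]addn1 PoszD addrK.
by have -> : k.+2%:Z - 2 = k%:Z by rewrite -[k.+2]addn2 PoszD addrK.
Qed.

Lemma gp1 : gp 1 = 1.
Proof.
rewrite /gp /= subnn bin1 bin0.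
by ring.
Qed.

Lemma gp2 : gp 2 = (1 - beta) / 2.
Proof.
by rewrite gpE /hp subnn bin0 bin1 bin2R expr0 expr1 -(natr1 q); field.
Qed.

Lemma gp_big r : (q.+2 < r)%N -> gp r = 0.
Proof.
case: r => [|[|k]] // h; rewrite gpE /hp subn2 /= !bin_small; try lia.
by ring.
Qed.

Lemma binSR k : k.+1%:R * ('C(q, k.+1))%:R = (q%:R - k%:R) * ('C(q, k))%:R :> rat.
Proof.
rewrite -natrM mul_bin_left natrM; case: (leqP k q) => h; first by rewrite natrB.
by rewrite bin_small // !mulr0.
Qed.

(** The algebraic form of a count in the extremal graphs: D = a_t on every t-clique, except that D =
    b_t = a_t + xi on those with two vertices in V_0, whose density is [hp t]. *)
Lemma gp_rec t : (2 <= t)%N ->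
  t.+1%:R * gp t.+1 = low_density beta t * gp t + density_gap beta q.+1 * hp t.
Proof.
case: t => [|[|k]] // _; rewrite !gpE /hp !subn2 /= /low_density /density_gap.
have E1 := binSR k; have E2 := binSR k.+1; have E3 := binSR k.+2.
rewrite !exprS.
move: E1 E2 E3; rewrite -(natr1 k.+2) -(natr1 k.+1) -(natr1 k) -(natr1 q.+1) -(natr1 q).
set C0 := 'C(q, k)%:R; set C1 := 'C(q, k.+1)%:R.
set C2 := 'C(q, k.+2)%:R; set C3 := 'C(q, k.+3)%:R => E1 E2 E3.
set B := beta ^+ k; set K := k%:R in E1 E2 E3 *; set u := q%:R in E1 E2 E3 *.
set m := 1 - u * beta; set d := 1 - (u + 1) * beta.
(* The coefficients are split so that every binomial 'C(q, j+1) also occurs multiplied by j + 1, the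
   form that [binSR] rewrites. *)
transitivity (((K + 1 + 1 + 1) * C3 * beta ^+ 3 +
   ((K + 1 + 1) * C2 + C2) * m * beta ^+ 2 +
   2^-1 * ((K + 1) * C1 + 2 * C1) * d * m * beta) * B); first by ring.
by rewrite E1 E2 E3 /m /d; field.
Qed.

(** In the extremal graphs a (t+1)-clique with two vertices in V_0 has t - 1 vertices elsewhere, and
    deleting any of them leaves a t-clique of the same kind, which has D = b_t. *)
Lemma hp_rec t : (2 <= t)%N ->
  (t%:R - 1) * hp t.+1 = high_density beta q.+1 t * hp t.
Proof.
case: t => [|[|k]] // _; rewrite /hp subSn // !subn2 /= /high_density.
have := binSR k; rewrite !exprS -(natr1 k.+1) -(natr1 k) -(natr1 q.+1) -(natr1 q) => E1.
transitivity (((k%:R + 1) * 'C(q, k.+1)%:R) *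
   (2^-1 * (1 - (q%:R + 1) * beta) * (1 - q%:R * beta) * (beta * beta ^+ k))).
  by ring.
by rewrite E1; ring.
Qed.

Lemma gp_identity t : (2 <= t)%N ->
  ((low_density beta t + high_density beta q.+1 t) * t.+1%:R - 2 + t.+1%:R * beta) * gp t.+1 =
  low_density beta t * high_density beta q.+1 t * gp t + (t%:R - 1) * (t.+2%:R * gp t.+2).
Proof.
move=> t2; rewrite (gp_rec (leqW t2)).
have -> : low_density beta t * high_density beta q.+1 t * gp t + (t%:R - 1) *
    (low_density beta t.+1 * gp t.+1 + density_gap beta q.+1 * hp t.+1) =
   low_density beta t * high_density beta q.+1 t * gp t + (t%:R - 1) * low_density beta t.+1 * gp t.+1 +
     density_gap beta q.+1 * ((t%:R - 1) * hp t.+1) by ring.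
rewrite hp_rec //.
have -> : low_density beta t * high_density beta q.+1 t * gp t + (t%:R - 1) * low_density beta t.+1 * gp t.+1 +
     density_gap beta q.+1 * (high_density beta q.+1 t * hp t) =
   high_density beta q.+1 t * (t.+1%:R * gp t.+1) + (t%:R - 1) * low_density beta t.+1 * gp t.+1.
  by rewrite (gp_rec t2); ring.
by rewrite /low_density -(natr1 t); ring.
Qed.

Hypotheses (xi0 : 0 <= density_gap beta q.+1) (xi_small : density_gap beta q.+1 * (2 * q.+1%:R) <= 1).
Local Notation P := (q.+2%:R : rat).

(** The worst case is t = p, where a_p = (1 - p xi)/P and p xi <= 1/2. *)
Lemma ac_ge t : (t <= q.+1)%N -> (2 * P)^-1 <= low_density beta t.
Proof.
move=> tq; have P0 : 0 < P by rewrite ltr0n.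
have h : t%:R <= q.+1%:R :> rat by rewrite ler_nat.
have b0 := beta_gt0 xi0.
apply: (@le_trans _ _ (1 - q.+1%:R * beta)); last first.
  by rewrite /low_density lerD2l lerN2 ler_wpM2r // ltW.
rewrite -[_^-1]mul1r ler_pdivrMr ?mulr_gt0 //.
have := xi_small; rewrite /density_gap -(natr1 q.+1); set p := q.+1%:R => hs.
have p0 : 0 <= p by rewrite ler0n.
nra.
Qed.

Lemma ac_gt0 t : (t <= q.+1)%N -> 0 < low_density beta t.
Proof.
by move=> /ac_ge; apply: lt_le_trans; rewrite invr_gt0 mulr_gt0 // ltr0n.
Qed.

Lemma bc_ge t : (t <= q.+1)%N -> P^-1 <= high_density beta q.+1 t.
Proof.
move=> tq; apply: le_trans (beta_ge xi0) _; rewrite /high_density ler_peMl ?(ltW (beta_gt0 xi0)) //.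
by rewrite -(natr1 q.+1) lerBrDl lerD2r ler_nat.
Qed.

Lemma bc_le1 t : (2 <= t)%N -> (t <= q.+1)%N -> high_density beta q.+1 t <= 1.
Proof.
move=> t2 tq; have := ac_gt0 tq; have b0 := beta_gt0 xi0.
have := ac_gt0 (leqnn q.+1).
have : 2 <= t%:R :> rat by rewrite ler_nat.
rewrite /low_density /high_density -(natr1 q.+1); nra.
Qed.

Lemma hp_ge0 t : 0 <= hp t.
Proof.
rewrite /hp !mulr_ge0 ?invr_ge0 ?ler0n ?exprn_ge0 ?(ltW (beta_gt0 xi0)) //.
  exact: ltW (ac_gt0 (leqnn _)).
exact: ltW (ac_gt0 (leqnSn _)).
Qed.

Lemma gp_ge_hp t : (2 <= t)%N -> hp t <= gp t.
Proof.
case: t => [|[|k]] // _; rewrite gpE lerDr.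
have x0 j : 0 <= beta ^+ j by apply: exprn_ge0; exact: ltW (beta_gt0 xi0).
have m0 : 0 <= 1 - q%:R * beta by exact: ltW (ac_gt0 (leqnSn _)).
by apply: addr_ge0; first exact: mulr_ge0; apply: mulr_ge0 => //; exact: mulr_ge0.
Qed.

Lemma gp_ge0 t : (2 <= t)%N -> 0 <= gp t.
Proof. move=> t2; exact: le_trans (hp_ge0 t) (gp_ge_hp t2). Qed.

Lemma gp_step_ge t : (2 <= t)%N -> low_density beta t * gp t <= t.+1%:R * gp t.+1.
Proof. by move=> t2; rewrite gp_rec // lerDl mulr_ge0 // hp_ge0. Qed.

Lemma gp_step_le t : (2 <= t)%N -> t.+1%:R * gp t.+1 <= high_density beta q.+1 t * gp t.
Proof.
move=> t2; rewrite gp_rec // bcE (mulrDl (low_density _ _) (density_gap _ _)) lerD2l ler_wpM2l //; exact: gp_ge_hp.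
Qed.

Lemma gp_le1 t : (2 <= t <= q.+2)%N -> gp t <= 1.
Proof.
case/andP; elim: t => // t IH; rewrite leq_eqVlt => /orP[/eqP[<-] _|].
  by rewrite gp2; have := beta_gt0 xi0; lra.
rewrite ltnS => t2 tq.
have g1 := IH t2 (ltnW tq).
have h := gp_step_le t2; have b1 := bc_le1 t2 tq.
have g0 := gp_ge0 t2; have g0' := gp_ge0 (leqW t2).
have : 1 <= t.+1%:R :> rat by rewrite ler1n.
nra.
Qed.

(** By [gp_step_ge] one level multiplies g by at least a_t/(t+1) >= 1/(2P * P). One such factor
    bounds g_2, and p of them suffice up to level p + 1. *)
Definition gmin : rat := (2 * P ^+ 2)^-1 ^+ q.+1.

Lemma gmin_gt0 : 0 < gmin.
Proof. by rewrite exprn_gt0 // invr_gt0 mulr_gt0 // exprn_gt0 // ltr0n. Qed.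

Lemma gp_ge t : (2 <= t <= q.+2)%N -> gmin <= gp t.
Proof.
set k := (2 * P ^+ 2)^-1.
have P1 : 1 <= P by rewrite ler1n.
have P0 : 0 < P by rewrite ltr0n.
have P20 : 0 < 2 * P ^+ 2 by rewrite mulr_gt0 // exprn_gt0.
have k0 : 0 < k by rewrite invr_gt0.
have k1 : k <= 1.
  by rewrite invf_le1 // mulr_ege1 ?exprn_ege1 // ler_nat.
move=> /andP[t2 tq]; apply: (@le_trans _ _ (k ^+ t.-1)).
  apply: ler_wiXn2l; [exact: ltW|exact: k1|lia].
elim: t t2 tq => // t IH; rewrite leq_eqVlt => /orP[/eqP[<-] _|].
  rewrite expr1 gp2; have := ac_ge (isT : (1 <= q.+1)%N); rewrite /low_density mul1r => h.
  apply: (@le_trans _ _ ((2 * P)^-1 / 2)); last by rewrite ler_wpM2r.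
  rewrite -invfM lef_pV2 ?posrE ?mulr_gt0 //.
  have : 2 <= P by rewrite ler_nat.
  by move: P0 => h1 h2; rewrite expr2; nra.
rewrite ltnS => t2 tq; have {}IH := IH t2 (ltnW tq).
have h := gp_step_ge t2; have ha := ac_ge tq.
have g0 := gp_ge0 t2.
have -> : t.+1.-1 = t.-1.+1 by case: (t) t2.
rewrite exprS.
apply: (@le_trans _ _ (k * gp t)); first by rewrite ler_pM2l.
have h2 : (2 * P)^-1 * gp t <= P * gp t.+1.
  apply: (@le_trans _ _ (low_density beta t * gp t)); first exact: ler_wpM2r.
  apply: le_trans h _; rewrite ler_wpM2r ?ler_nat //; apply: gp_ge0; exact: leqW.
have -> : k * gp t = P^-1 * ((2 * P)^-1 * gp t).
  by rewrite /k expr2 !invfM; ring.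
by rewrite mulrC ler_pdivrMr // (mulrC (gp t.+1)).
Qed.

Lemma gp_gt0 t : (2 <= t <= q.+2)%N -> 0 < gp t.
Proof. by move=> h; apply: lt_le_trans gmin_gt0 (gp_ge h). Qed.

End ExtremalDensity.

(** The three summands bound, in units of c Y_2, the errors of [gap_rec]: the mismatch of the excess
    terms, the bad cliques of [lower_pointwise], and the overflow on good cliques. *)
Definition err_const (q : nat) : rat :=
  1 + q.+1%:R + q.+1%:R ^+ 2 * (2 * q.+2%:R) * Cov q.+1.
(** One iteration solves [gap_rec] for [gap t]: it divides by a_t b_t >= 1/(2 P^2) and uses
    (t+1)(t-1) <= p^2. The start 0 corresponds to [gap_last], and j counts levels down from p +
    1. *)
Definition gap_const (q j : nat) : rat :=
  iter j (fun K => 2 * q.+2%:R ^+ 2 * (q.+1%:R ^+ 2 * K + err_const q)) 0.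
(** The square of [gmin] bounds g_t g_(t+1), the denominator that turns a gap into a difference of
    two ratios k/g. *)
Definition loss_const (q : nat) : rat :=
  gap_const q q.+2 / gmin q ^+ 2.

Lemma Cov_ge0 p : 0 <= Cov p.
Proof. by rewrite mulr_ge0 ?ler0n // exprn_ge0 // exprn_ge0. Qed.

Lemma err_const_ge0 q : 0 <= err_const q.
Proof.
have h1 : 0 <= q.+1%:R ^+ 2 :> rat by exact: exprn_ge0.
have h2 : 0 <= 2 * q.+2%:R :> rat by exact: mulr_ge0.
have h3 := Cov_ge0 q.+1.
by rewrite /err_const !addr_ge0 ?ler0n // mulr_ge0 // mulr_ge0.
Qed.

Lemma gap_const_ge0 q j : 0 <= gap_const q j.
Proof.
elim: j => // j IH; apply: mulr_ge0; first by rewrite mulr_ge0 // exprn_ge0.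
by apply: addr_ge0 (err_const_ge0 q); apply: mulr_ge0 IH; exact: exprn_ge0.
Qed.

Lemma gap_const_mono q : {homo gap_const q : i j / (i <= j)%N >-> i <= j}.
Proof.
suff st j : gap_const q j <= gap_const q j.+1.
  by apply: homo_leq => //; exact: le_trans.
elim: j => [|j IH]; first exact: gap_const_ge0.
apply: ler_wpM2l; first by rewrite mulr_ge0 // exprn_ge0.
by rewrite lerD2r; apply: ler_wpM2l IH; exact: exprn_ge0.
Qed.

(** * Monotonicity of k_t/g_t up to errors that Y_2 controls *)

Section Stability.
Variables (n : nat) (e : rel 'I_n) (beta : rat).
Hypotheses (eG : simple_graph e) (n0 : (0 < n)%N).
Hypothesis degG : forall x, (1 - beta) * n%:R <= (deg e x)%:R.
Variables (q : nat) (c : rat).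
Local Notation P := (q.+2%:R : rat).
Local Notation p := (q.+1%:R : rat).
Hypotheses (c0 : 0 < c) (xi0 : 0 <= density_gap beta q.+1).
Hypothesis c_small : c * (4 * q.+3%:R ^+ 3) <= 1.
Hypothesis xi_c : density_gap beta q.+1 <= c ^+ 2.

Local Notation kap := (clique_density e).
Local Notation gp := (gp q beta).
Local Notation hp := (hp q beta).
Local Notation excess := (excess e beta q.+1 c).
Local Notation overflow := (overflow e beta q.+1).
Local Notation ac := (low_density beta).
Local Notation bc := (high_density beta q.+1).
Local Notation w := (bad_weight e beta q.+1 c).
Local Notation xi := (density_gap beta q.+1).

(* [(t+1)(g_t k_(t+1) - g_(t+1) k_t)] corrected by the excess, so that the truncation
   terms of consecutive levels cancel in [gap_rec]. *)
Definition gap t : rat :=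
  t.+1%:R * (gp t * kap t.+1 - gp t.+1 * kap t) - gp t * excess t.

Lemma xi_small : xi * (2 * p) <= 1.
Proof.
have xc : xi <= c := xi_le_c c0 c_small xi_c.
have h := c_small; have h0 := xi0.
have h1 : 2 * p <= 4 * q.+3%:R ^+ 3.
  have s1 : p <= q.+3%:R by rewrite ler_nat; lia.
  have s2 : q.+3%:R <= q.+3%:R ^+ 3 :> rat by apply: ler_eXnr => //; rewrite ler1n.
  by have := ler0n rat q.+1; lra.
have h2 : 0 <= 2 * p by rewrite mulr_ge0.
apply: le_trans h; apply: ler_pM => //.
Qed.

(** [clique_ineq] is multiplied by (t+1) g_(t+1), and [gp_identity] cancels the terms in k_(t+1).
    The excess at level t then has coefficient a_t (a_t g_t + xi h_t) by [gp_rec], while a_t b_t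
    [gap t] asks for a_t b_t g_t; the two terms with a factor xi are the difference. *)
Lemma gap_rec_raw t : (2 <= t)%N ->
  (t%:R + 1) * (t%:R - 1) * gap t.+1 - xi * ac t * gp t * excess t
   - t.+1%:R * gp t.+1 * (t%:R * (t%:R - 1) / 2 * (xi + c) * overflow t +
        (t%:R - 1) * xi * w)
  + ac t * excess t * xi * hp t
  <= ac t * bc t * gap t.
Proof.
move=> t2.
have I := clique_ineq eG n0 degG c0 xi0 t2.
have g0 : 0 <= t.+1%:R * gp t.+1.
  by rewrite mulr_ge0 // (gp_ge0 xi0 xi_small) // leqW.
have {I} := ler_wpM2l g0 I.
have R1 := gp_rec q beta t2; have R2 := gp_identity q beta t2.
rewrite /gap -(natr1 t).
set X := overflow t; set Y := excess t; set Z := excess t.+1; set W := w.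
set k0 := kap t; set k1 := kap t.+1; set k2 := kap t.+2.
move: R1 R2; rewrite bcE -(natr1 t.+1) -(natr1 t).
set a := ac t; set x := xi; set T := t%:R.
set g0' := gp t; set g1 := gp t.+1; set g2 := gp t.+2; set h := hp t.
move=> R1 R2 I.
have E1 : (T + 1) * g1 * (a * Y) = a * Y * (a * g0' + x * h) by rewrite -R1; ring.
have E2 : (T + 1) * g1 * (((a + (a + x)) * (T + 1) - 2 + (T + 1) * beta) * k1) =
   (T + 1) * k1 * (a * (a + x) * g0' + (T - 1) * ((T + 1 + 1) * g2)).
  by rewrite -R2; ring.
lra.
Qed.

(** As g_(p+2) = 0, this gap is g_(p+1) times the average truncated density of (p+1)-cliques, and
    the truncation level b_(p+1) is 0. *)
Lemma gap_last : 0 <= gap q.+2.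
Proof.
rewrite /gap (@gp_big q beta q.+3) // mul0r subr0 mulrCA -mulrBr.
rewrite mulr_ge0 ?(gp_ge0 xi0 xi_small) //.
rewrite -avg_trunc //; apply: avg_ge0 => // S St.
rewrite /trunc (cliques_card St); case: ifP => _; last exact: dens_ge0.
by rewrite le_min dens_ge0 /high_density subrr mul0r.
Qed.

Local Notation Y2 := (excess 2).

Lemma Y2_ge0 : 0 <= Y2. Proof. exact: excess_ge0. Qed.

Lemma ac_le1 t : ac t <= 1.
Proof. by rewrite gerBl mulr_ge0 // (ltW (beta_gt0 xi0)). Qed.

Lemma bad_weight_ge0 : 0 <= w.
Proof. exact: avg_ge0. Qed.

Lemma xi_bad_weight : xi * w <= c * Y2.
Proof.
have h : c * w <= Y2 by exact: bad_weight_le.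
have w0 := bad_weight_ge0.
apply: (@le_trans _ _ (c ^+ 2 * w)); first exact: ler_wpM2r.
by rewrite expr2 -mulrA ler_pM2l.
Qed.

Lemma overflow_Y2 t : (t <= q.+2)%N -> overflow t <= Cov q.+1 * (2 * P) * Y2.
Proof.
move=> tq; have h : overflow t <= Cov q.+1 * kap q.+3 by exact: overflow_le.
apply: le_trans h _.
rewrite -mulrA ler_wpM2l ?Cov_ge0 //.
exact: kap_big_le.
Qed.

Lemma gap_rec t : (2 <= t <= q.+1)%N ->
  (t%:R + 1) * (t%:R - 1) * gap t.+1 - err_const q * (c * Y2) <=
  ac t * bc t * gap t.
Proof.
case/andP => t2 tq.
have R := gap_rec_raw t2.
have y0 : 0 <= excess t by exact: excess_ge0.
have a0 := ltW (ac_gt0 xi0 xi_small tq); have a1 := ac_le1 t.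
have g0 := gp_ge0 xi0 xi_small t2.
have g1 : gp t <= 1 by apply: gp_le1 xi0 xi_small _ _; rewrite t2 ltnW.
have h0 := hp_ge0 xi0 xi_small t.
have w0 := bad_weight_ge0; have Y0 := Y2_ge0.
have ewY : excess t <= w by apply: excess_le; rewrite ?t2 //= ltnW.
have E1 : xi * ac t * gp t * excess t <= c * Y2.
  apply: le_trans xi_bad_weight.
  rewrite -!mulrA ler_wpM2l //; apply: le_trans ewY.
  by rewrite mulrA ler_piMl // mulr_ile1.
have G1 : t.+1%:R * gp t.+1 <= 1.
  apply: le_trans (gp_step_le xi0 xi_small t2) _.
  have b1 := bc_le1 xi0 xi_small t2 tq.
  have b0 : 0 <= bc t.
    by apply: le_trans (bc_ge xi0 tq); rewrite invr_ge0.
  by rewrite mulr_ile1.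
have G0 : 0 <= t.+1%:R * gp t.+1.
  by rewrite mulr_ge0 // (gp_ge0 xi0 xi_small) // leqW.
have T1 : 1 <= t%:R :> rat by rewrite ler1n ltnW.
have T10 : 0 <= t%:R - 1 :> rat by rewrite subr_ge0.
have Tp : t%:R <= p by rewrite ler_nat.
have xc : xi <= c := xi_le_c c0 c_small xi_c.
have o0 : 0 <= overflow t by apply: avg_ge0 => // S _; rewrite le_max lexx.
have T2 : t%:R * (t%:R - 1) <= p ^+ 2.
  by rewrite expr2; apply: ler_pM; rewrite ?ler0n ?subr_ge0 //; lra.
have E2 : t%:R * (t%:R - 1) / 2 * (xi + c) * overflow t <=
   p ^+ 2 * (2 * P) * Cov q.+1 * (c * Y2).
  apply: (@le_trans _ _ (p ^+ 2 * c * (Cov q.+1 * (2 * P) * Y2))); last first.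
    by rewrite le_eqVlt; apply/orP; left; apply/eqP; ring.
  apply: ler_pM => //; last by apply: overflow_Y2; exact: ltnW.
    apply: mulr_ge0; last by apply: addr_ge0 => //; exact: ltW.
    by rewrite divr_ge0 // mulr_ge0 // subr_ge0.
  have -> : t%:R * (t%:R - 1) / 2 * (xi + c) = t%:R * (t%:R - 1) * ((xi + c) / 2).
    by ring.
  apply: ler_pM => //; first by rewrite mulr_ge0 // subr_ge0.
    by rewrite divr_ge0 // addr_ge0 // ltW.
  lra.
have E3 : (t%:R - 1) * xi * w <= p * (c * Y2).
  rewrite -mulrA; apply: ler_pM.
  - by rewrite subr_ge0.
  - exact: mulr_ge0.
  - by apply: le_trans Tp; rewrite gerBl.
  - exact: xi_bad_weight.
set E := t%:R * (t%:R - 1) / 2 * (xi + c) * overflow t + (t%:R - 1) * xi * w in R.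
have E0 : 0 <= E.
  apply: addr_ge0; last by apply: mulr_ge0 => //; exact: mulr_ge0.
  apply: mulr_ge0 => //; apply: mulr_ge0; last by apply: addr_ge0 => //; exact: ltW.
  by apply: divr_ge0 => //; exact: mulr_ge0.
have E4 : t.+1%:R * gp t.+1 * E <= E by rewrite ler_piMl.
have E5 : 0 <= ac t * excess t * xi * hp t.
  by apply: mulr_ge0 => //; apply: mulr_ge0 => //; exact: mulr_ge0.
apply: le_trans R.
have -> : err_const q * (c * Y2) =
  c * Y2 + p * (c * Y2) + p ^+ 2 * (2 * P) * Cov q.+1 * (c * Y2).
  by rewrite /err_const; ring.
have : E <= p * (c * Y2) + p ^+ 2 * (2 * P) * Cov q.+1 * (c * Y2).
  by rewrite /E; lra.
lra.
Qed.

Lemma gap_ge t : (2 <= t <= q.+2)%N -> - gap_const q q.+2 * (c * Y2) <= gap t.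
Proof.
case/andP => t2 tq.
have Y0 := Y2_ge0; have cY : 0 <= c * Y2 by rewrite mulr_ge0 // ltW.
suff H j : (2 <= q.+2 - j)%N -> - gap_const q j * (c * Y2) <= gap (q.+2 - j).
  have := H (q.+2 - t)%N; rewrite subKn // => /(_ t2).
  apply: le_trans; rewrite ler_wpM2r // lerN2; apply: gap_const_mono; exact: leq_subr.
elim: j => [|j IH] hj; first by rewrite subn0 oppr0 mul0r gap_last.
have sE : (q.+2 - j)%N = (q.+2 - j.+1).+1 by lia.
rewrite sE in IH; move: hj IH; set s := (q.+2 - j.+1)%N => hj IH.
have sq : (s <= q.+1)%N by rewrite /s; lia.
have {IH} IH := IH (leqW hj).
have R : (s%:R + 1) * (s%:R - 1) * gap s.+1 - err_const q * (c * Y2) <=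
   ac s * bc s * gap s by apply: gap_rec; rewrite hj.
set K := gap_const q j in IH; have K0 : 0 <= K := gap_const_ge0 q j.
have S1 : 1 <= s%:R :> rat by rewrite ler1n ltnW.
have Sp : s%:R <= p by rewrite ler_nat.
have S2 : (s%:R + 1) * (s%:R - 1) <= p ^+ 2.
  by rewrite expr2; nra.
have S0 : 0 <= (s%:R + 1) * (s%:R - 1) :> rat.
  by apply: mulr_ge0; lra.
have L1 : - (p ^+ 2 * K + err_const q) * (c * Y2) <= ac s * bc s * gap s.
  apply: le_trans R; have := ler_wpM2l S0 IH.
  have : (s%:R + 1) * (s%:R - 1) * (K * (c * Y2)) <= p ^+ 2 * (K * (c * Y2)).
    by apply: ler_wpM2r => //; exact: mulr_ge0.
  lra.
have -> : gap_const q j.+1 = 2 * P ^+ 2 * (p ^+ 2 * K + err_const q) by [].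
set M := p ^+ 2 * K + err_const q in L1 *.
have M0 : 0 <= M.
  by apply: addr_ge0 (err_const_ge0 q); apply: mulr_ge0 K0; exact: exprn_ge0.
have P0 : 0 < P by rewrite ltr0n.
have P20 : 0 < 2 * P ^+ 2 by rewrite mulr_gt0 // exprn_gt0.
(* The lower bound on a_s b_s is useful only for a negative gap; for a nonnegative one the claim is
   trivial. *)
have [gs|gs] := leP 0 (gap s).
  apply: le_trans gs; rewrite mulNr oppr_le0; apply: mulr_ge0 => //.
  by apply: mulr_ge0 => //; exact: ltW.
have ab : (2 * P ^+ 2)^-1 <= ac s * bc s.
  have -> : (2 * P ^+ 2)^-1 = (2 * P)^-1 * P^-1 by rewrite expr2 !invfM; ring.
  apply: ler_pM; first by rewrite invr_ge0 mulr_ge0.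
  - by rewrite invr_ge0.
  - exact: (ac_ge xi0 xi_small sq).
  - exact: (bc_ge xi0 sq).
have L2 : ac s * bc s * gap s <= (2 * P ^+ 2)^-1 * gap s.
  by apply: ler_wnM2r ab; exact: ltW.
have := ler_wpM2l (ltW P20) (le_trans L1 L2).
rewrite [X in _ <= X -> _]mulrA divff ?gt_eqF // mul1r; apply: le_trans.
by rewrite !mulNr !mulrN !mulrA.
Qed.

Hypothesis c_loss : c * loss_const q * (6 * P) <= 1.

(** Dividing by (t+1) g_t g_(t+1) turns [gap t], with its excess restored, into the increment of the
    ratio. The restored excess is dropped except at t = 2, where g_3 <= 1 leaves a gain of Y_2/3. *)
Lemma kap_step t : (2 <= t <= q.+1)%N ->
  kap t / gp t + (t == 2%N)%:R / 3 * Y2 - loss_const q * c * Y2 <=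
  kap t.+1 / gp t.+1.
Proof.
case/andP => t2 tq.
have G : - gap_const q q.+2 * (c * Y2) <= gap t by apply: gap_ge; rewrite t2 ltnW.
have Y0 := Y2_ge0; have cY : 0 <= c * Y2 by rewrite mulr_ge0 // ltW.
have r1 : (2 <= t <= q.+2)%N by rewrite t2 ltnW.
have r2 : (2 <= t.+1 <= q.+2)%N by rewrite (leqW t2).
have g0 := gp_gt0 xi0 xi_small r1.
have g0' := gp_gt0 xi0 xi_small r2.
have m1 := gp_ge xi0 xi_small r1; have m2 := gp_ge xi0 xi_small r2.
have l2 := gp_le1 xi0 xi_small r2.
have mp := gmin_gt0 q.
have yt : 0 <= excess t by exact: excess_ge0.
have t0 : 0 < t.+1%:R :> rat by rewrite ltr0n.
set u := (t.+1%:R * gp t * gp t.+1)^-1.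
have D0 : 0 < t.+1%:R * gp t * gp t.+1 by apply: mulr_gt0 => //; exact: mulr_gt0.
have u0 : 0 < u by rewrite invr_gt0.
have E : kap t.+1 / gp t.+1 = kap t / gp t + u * (gap t + gp t * excess t).
  by rewrite /gap /u; field; rewrite (gt_eqF g0') (gt_eqF g0) nat1r pnatr_eq0.
rewrite E -addrA lerD2l mulrDr addrC; apply: lerD.
  have u1 : u <= (gmin q ^+ 2)^-1.
    rewrite lef_pV2 ?posrE //; last exact: exprn_gt0.
    apply: (@le_trans _ _ (gp t * gp t.+1)).
      by rewrite expr2; apply: ler_pM => //; exact: ltW.
    rewrite -mulrA; apply: ler_peMl; last by rewrite ler1n.
    by apply: mulr_ge0; exact: ltW.
  have K0 : 0 <= gap_const q q.+2 * (c * Y2).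
    by rewrite mulr_ge0 ?gap_const_ge0.
  have h := ler_wpM2l (ltW u0) G; apply: le_trans h.
  rewrite !mulNr mulrN lerN2.
  have -> : loss_const q * c * Y2 = (gmin q ^+ 2)^-1 * (gap_const q q.+2 * (c * Y2)).
    by rewrite /loss_const; ring.
  exact: ler_wpM2r.
have -> : u * (gp t * excess t) = excess t / (t.+1%:R * gp t.+1).
  by rewrite /u; field; rewrite (gt_eqF g0') (gt_eqF g0) nat1r pnatr_eq0.
case: eqVneq => [E2|_]; last first.
  by rewrite !mul0r divr_ge0 // mulr_ge0 // ltW.
rewrite mul1r [_ * Y2]mulrC -E2; apply: ler_wpM2l => //.
by rewrite lef_pV2 ?posrE ?mulr_gt0 // ler_piMr // ltW.
Qed.

(** The gain Y_2/3 occurs once and the loss at most P times; [c_loss] limits the total loss to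
    Y_2/6. *)
Lemma kap_ratio_ge r : (3 <= r <= q.+2)%N ->
  kap 2 / gp 2 + Y2 / 6 <= kap r / gp r.
Proof.
move=> r3; have Y0 := Y2_ge0.
have L0 : 0 <= loss_const q * c * Y2.
  rewrite mulr_ge0 // mulr_ge0 ?(ltW c0) // divr_ge0 ?gap_const_ge0 //.
  by rewrite exprn_ge0 // ltW // gmin_gt0.
have H : kap 2 / gp 2 + Y2 / 3 - (r - 2)%:R * (loss_const q * c * Y2) <= kap r / gp r.
  case/andP: r3; elim: r => // r IH; rewrite leq_eqVlt => /orP[/eqP[<-] q0|].
    have := kap_step (q0 : (2 <= 2 <= q.+1)%N).
    by rewrite eqxx mul1r (_ : (3 - 2)%N = 1%N) //; lra.
  rewrite ltnS => r2 rq; have {}IH := IH r2 (ltnW rq).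
  have T : (2 <= r <= q.+1)%N by rewrite (ltnW r2); exact: rq.
  have := kap_step T.
  rewrite (gtn_eqF r2) mulr0n !mul0r.
  rewrite subSn ?(ltnW r2) // -(natr1 (r - 2)); lra.
apply: le_trans H.
have rP : (r - 2)%:R <= P by rewrite ler_nat; lia.
have h1 : (r - 2)%:R * (loss_const q * c * Y2) <= P * (loss_const q * c * Y2).
  exact: ler_wpM2r.
have := ler_wpM2r Y0 c_loss; lra.
Qed.

Lemma kap2_ge : gp 2 <= kap 2.
Proof.
have := avg_dens eG 1; have : ac 1 * kap 1 <= clique_avg e 1 (density e).
  rewrite -avgC; apply: avg_le => // S S1; rewrite -(cliques_card S1).
  exact: dens_ge.
rewrite (kap1 e n0).
rewrite gp2 /low_density; lra.
Qed.

Lemma kap_ge r : (3 <= r <= q.+2)%N ->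
  gp r * (1 + Y2 / 6) <= kap r.
Proof.
move=> r3.
have r2 : (2 <= r <= q.+2)%N by case/andP: r3 => /ltnW-> ->.
have g0 := gp_gt0 xi0 xi_small r2.
rewrite mulrC -ler_pdivlMr //; apply: le_trans (kap_ratio_ge r3).
rewrite lerD2r ler_pdivlMr ?mul1r ?kap2_ge //.
exact: (gp_gt0 xi0 xi_small (isT : (2 <= 2 <= q.+2)%N)).
Qed.


Lemma kap_ratio_mono s r : Y2 = 0 -> (2 <= s <= r)%N -> (r <= q.+2)%N ->
  kap s / gp s <= kap r / gp r.
Proof.
move=> Y20 /andP[s2]; elim: r => [|r IH]; first by rewrite leqn0 => /eqP->.
rewrite leq_eqVlt => /orP[/eqP-> //|]; rewrite ltnS => sr rq.
apply: le_trans (IH sr (ltnW rq)) _.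
have T : (2 <= r <= q.+1)%N by rewrite (leq_trans s2 sr); exact: rq.
by have := kap_step T; rewrite Y20 !mulr0 addr0 subr0.
Qed.

(** * Consequences of equality at one level r *)

Section Equality.
Variable r : nat.
Hypotheses (r3 : (3 <= r <= q.+2)%N) (kr_eq : kap r = gp r).

Let r2 : (2 <= r <= q.+2)%N. Proof. by case/andP: r3 => /ltnW-> ->. Qed.

Lemma eq_q_gt0 : (1 <= q)%N. Proof. by case/andP: r3 => h1 h2; exact: leq_trans h1 h2. Qed.

Lemma eq_Y2 : Y2 = 0.
Proof.
apply: le_anti; rewrite Y2_ge0 andbT; have := kap_ge r3; rewrite kr_eq.
rewrite mulrDr mulr1 gerDl pmulr_rle0; first lra.
exact: (gp_gt0 xi0 xi_small r2).
Qed.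

Lemma eq_kap2 : kap 2 = gp 2.
Proof.
apply: le_anti; rewrite kap2_ge andbT.
have g2 : 0 < gp 2 by exact: (gp_gt0 xi0 xi_small (isT : (2 <= 2 <= q.+2)%N)).
have := kap_ratio_ge r3; rewrite eq_Y2 mul0r addr0 kr_eq divff.
  by rewrite ler_pdivrMr // mul1r.
by rewrite gt_eqF // (gp_gt0 xi0 xi_small r2).
Qed.

Lemma eq_regular x : (deg e x)%:R = (1 - beta) * n%:R.
Proof.
have A : clique_avg e 1 (fun S => density e S - ac 1) = 0.
  rewrite avgD avgC (kap1 e n0) (avg_dens eG) eq_kap2 gp2 /low_density; lra.
have S1 : [set x] \in cliques e 1.
  rewrite inE cards1 eqxx /=; apply/cliqueP => y z.
  by rewrite !inE => /eqP-> /eqP->; rewrite eqxx.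
have pos S : S \in cliques e 1 -> 0 <= density e S - ac 1.
  by move=> hS; rewrite subr_ge0 -(cliques_card hS); exact: dens_ge.
have := avg_eq0 n0 pos A S1; rewrite /low_density mul1r /density => E.
have -> : deg e x = #|common e [set x]|.
  rewrite -card_nbh -[[set x]]setU0 commonU1 //; apply: eq_card => y.
  by rewrite !inE sub0set andbT.
have N0 := N_neq0 n0.
rewrite -[LHS](divfK N0); congr (_ * _); lra.
Qed.

Lemma eq_bad_weight : w = 0.
Proof.
apply: le_anti; rewrite bad_weight_ge0 andbT.
have : c * w <= Y2 by exact: bad_weight_le.
by rewrite eq_Y2 pmulr_rle0.
Qed.

Lemma eq_not_bad S : bad e beta q.+1 c S = false.
Proof.
apply/existsP => -[A /andP[_ bA]].
have A2 : A \in cliques e 2 by case/andP: bA.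
have := avg_eq0 n0 _ eq_bad_weight A2; rewrite bA => /(_ (fun _ _ => ler0n _ _)).
by move/eqP; rewrite oner_eq0.
Qed.

Lemma eq_trunc S : trunc e beta q.+1 c S = density e S.
Proof. by rewrite /trunc eq_not_bad. Qed.

Lemma eq_kap_big : kap q.+3 = 0.
Proof.
apply: le_anti; rewrite kap_ge0 // andbT.
have : kap q.+3 <= 2 * P * Y2 by exact: kap_big_le.
by rewrite eq_Y2 mulr0.
Qed.

Lemma eq_no_big_clique Q : Q \notin cliques e q.+3.
Proof.
apply/negP => Qb; have := eq_kap_big; rewrite /clique_density => /eqP.
rewrite mulf_eq0 invr_eq0 (gt_eqF (NX_gt0 n0 _)) orbF pnatr_eq0 cards_eq0.
by move/eqP => E; rewrite E inE in Qb.
Qed.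

Lemma eq_excess t : excess t = 0.
Proof.
by rewrite /excess /clique_avg big1 ?mul0r // => S _; rewrite eq_trunc subrr.
Qed.

(** Equality at a single r reaches all levels, also those above r. The ratio k/g is monotone, equal
    to 1 at 2 and at r, so it is at most 1 at 3 and [gap 2] vanishes. Then [gap_rec], free of error
    when Y_2 = 0, bounds each further gap above by 0, and [gap_ge] bounds it below. *)
Lemma eq_gap t : (2 <= t <= q.+2)%N -> gap t = 0.
Proof.
case/andP; elim: t => // t IH; rewrite leq_eqVlt => /orP[/eqP[<-] _|].
  have g2 := gp_gt0 xi0 xi_small (isT : (2 <= 2 <= q.+2)%N).
  have T3 : (2 <= 3 <= q.+2)%N by have := eq_q_gt0; lia.
  have g3 := gp_gt0 xi0 xi_small T3.
  case/andP: (r3) => h3 hr.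
  have := kap_ratio_mono eq_Y2 (h3 : (2 <= 3 <= r)%N) hr.
  rewrite kr_eq divff ?gt_eqF ?(gp_gt0 xi0 xi_small r2) // ler_pdivrMr // mul1r => k3.
  have := gap_ge (isT : (2 <= 2 <= q.+2)%N); rewrite eq_Y2 !mulr0 => G0.
  apply: le_anti; rewrite G0 andbT /gap eq_excess eq_kap2 mulr0 subr0.
  by rewrite [gp 3 * _]mulrC -mulrBr !pmulr_rle0 // subr_le0.
rewrite ltnS => t2 tq.
have T0 : (2 <= t <= q.+1)%N by rewrite t2.
have G := gap_rec T0; rewrite eq_Y2 !mulr0 subr0 (IH t2 (ltnW tq)) mulr0 in G.
have T : (2 <= t.+1 <= q.+2)%N by rewrite leqW.
have := gap_ge T; rewrite eq_Y2 !mulr0 => G0.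
apply: le_anti; rewrite G0 andbT; rewrite pmulr_rle0 // in G.
have : 2 <= t%:R :> rat by rewrite ler_nat.
by move=> h; apply: mulr_gt0; lra.
Qed.

Let q1 := eq_q_gt0.

(** A zero gap at level p says that k_p and k_(p+1) are in the ratio of g_p and g_(p+1), so they may
    replace them in [gp_identity], whose last term contains g_(p+2) = 0. *)
Lemma eq_identity :
  ((ac q.+1 + bc q.+1) * q.+2%:R - 2 + q.+2%:R * beta) * kap q.+2 =
  ac q.+1 * bc q.+1 * kap q.+1.
Proof.
have T : (2 <= q.+1 <= q.+2)%N by rewrite ltnS q1 leqW.
have g0 := gp_gt0 xi0 xi_small T.
have := eq_gap T; rewrite /gap eq_excess mulr0 subr0 => /eqP.
rewrite mulf_eq0 pnatr_eq0 /= subr_eq0 => /eqP E.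
have I := @gp_identity q beta q.+1 q1; rewrite (@gp_big q beta q.+3) // !mulr0 addr0 in I.
apply: (mulfI (negbT (gt_eqF g0))).
transitivity (((ac q.+1 + bc q.+1) * q.+2%:R - 2 + q.+2%:R * beta) * (gp q.+1 * kap q.+2)).
  by ring.
rewrite E mulrA I; ring.
Qed.

Lemma eq_dens_le S : S \in cliques e q.+1 -> density e S <= bc q.+1.
Proof.
move=> Sq; have O : overflow q.+1 = 0.
  apply: le_anti; apply/andP; split.
    by have := overflow_Y2 (leqnSn q.+1); rewrite eq_Y2 mulr0.
  by apply: avg_ge0 => // A _; rewrite le_max lexx.
have pos A : A \in cliques e q.+1 -> 0 <= Num.max 0 (density e A - bc q.+1).
  by rewrite le_max lexx.
have /eqP := avg_eq0 n0 pos O Sq; rewrite eq_maxl subr_le0 //.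
Qed.

Let facesS (T : {set 'I_n}) := \sum_(x in T) density e (T :\ x) - (2 - q.+2%:R * beta).

(** These are the two slacks given away at level p, both nonnegative. In the sum of their averages
    the terms in D^2 cancel by [avg_densM], and [eq_identity] makes the rest 0, so both vanish on
    every clique. *)
Lemma eq_slack : (forall S, S \in cliques e q.+1 ->
     (density e S - ac q.+1) * (bc q.+1 - density e S) = 0) /\
  (forall T, T \in cliques e q.+2 -> facesS T = 0).
Proof.
have p1 S : S \in cliques e q.+1 -> 0 <= (density e S - ac q.+1) * (bc q.+1 - density e S).
  move=> Sq; apply: mulr_ge0; last by rewrite subr_ge0 eq_dens_le.
  by rewrite subr_ge0 -{1}(cliques_card Sq); exact: dens_ge.
have p2 T : T \in cliques e q.+2 -> 0 <= facesS T.
  move=> Tq; have T0 : (0 < #|T|)%N by rewrite (cliques_card Tq).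
  have := sum_dens_faces eG n0 degG T0; rewrite (cliques_card Tq) /facesS => h.
  rewrite subr_ge0; apply: le_trans h; rewrite lerDl mulr_ge0 ?dens_ge0 //.
  by rewrite subr_ge0 ler_nat.
have E : clique_avg e q.+1 (fun S => (density e S - ac q.+1) * (bc q.+1 - density e S)) +
    clique_avg e q.+2 facesS = 0.
  transitivity (((ac q.+1 + bc q.+1) * clique_avg e q.+1 (density e) - ac q.+1 * bc q.+1 * kap q.+1
    - clique_avg e q.+1 (fun S => density e S * density e S)) +
    (clique_avg e q.+2 (fun T => \sum_(x in T) density e (T :\ x)) - (2 - q.+2%:R * beta) * kap q.+2)).
    rewrite /facesS avgD avgC mulNr; congr (_ + _).
    rewrite -avgZ -avgC -!avgN -!avgD; apply: eq_avg => S _; ring.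
  rewrite (avg_densM eG) (avg_dens eG) -eq_identity; ring.
have z1 := avg_ge0 n0 p1; have z2 := avg_ge0 n0 p2.
split.
  by apply: avg_eq0 => //; lra.
by apply: avg_eq0 => //; lra.
Qed.

End Equality.
End Stability.

(** * Recovering the partition from a (p+1)-clique with tight faces *)

Section Structure.
Variables (n : nat) (e : rel 'I_n) (beta : rat) (q : nat).
Hypotheses (eG : simple_graph e) (n0 : (0 < n)%N).
Implicit Types (S T A : {set 'I_n}) (x y : 'I_n).
Local Notation N := (n%:R : rat).

Definition multipartite (part : 'I_n -> nat) : Prop :=
  [/\ forall x, (part x < q.+1)%N,
      forall i : nat, (0 < i < q.+1)%N ->
         (#|[set x | part x == i]|%:R : rat) = beta * N,
      forall x y, part x != part y -> e x y &
      forall x y, part x = part y -> part x != 0%N -> ~~ e x y].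

Lemma multipartite_card0 part : multipartite part ->
  #|[set x | part x == 0%N]|%:R = (1 - q%:R * beta) * N.
Proof.
case=> lt sz _ _.
have E : \sum_(i < q.+1) #|[set x | part x == i]|%:R = N :> rat.
  rewrite -[in RHS](card_ord n) -sum1_card natr_sum.
  rewrite (partition_big (fun x => Ordinal (lt x)) predT) //=.
  apply: eq_bigr => i _; rewrite -sum1_card natr_sum.
  by apply: eq_bigl => x; rewrite !inE -val_eqE.
move: E; rewrite big_ord_recl /= (eq_bigr (fun=> beta * N)); last first.
  by move=> i _; rewrite sz //= /bump /= add1n ltnS.
rewrite sumr_const card_ord -(mulr_natl (beta * N)) => E; lra.
Qed.

Hypothesis degE : forall x, (deg e x)%:R = (1 - beta) * N.

Lemma card_nonnbh x : #|~: nbh e x|%:R = beta * N.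
Proof.
have := cardsC (nbh e x); rewrite card_ord card_nbh => /(congr1 (fun k => k%:R : rat)).
rewrite natrD degE; lra.
Qed.

Lemma multipartite_deg0 part x : multipartite part -> part x = 0%N ->
  #|[set y in [set z | part z == 0%N] | e x y]|%:R = (1 - q.+1%:R * beta) * N.
Proof.
move=> M x0; have V0 := multipartite_card0 M; case: M => _ _ cross _.
set V := [set z | part z == 0%N] in V0 *.
have E : ~: nbh e x = V :\: nbh e x.
  apply/setP => y; rewrite !inE; case: (eqVneq (part y) 0%N) => [//|ny].
    by rewrite andbT.
  by rewrite andbF cross // x0 eq_sym.
have := cardsID (nbh e x) V => /(congr1 (fun k => k%:R : rat)).
rewrite natrD -E V0 card_nonnbh.
have -> : [set y in V | e x y] = V :&: nbh e x.
  by apply/setP => y; rewrite !inE.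
rewrite -(natr1 q); lra.
Qed.

Hypothesis no_big : forall Q, Q \notin cliques e q.+3.

Variable T : {set 'I_n}.
Hypothesis TK : T \in cliques e q.+2.
Hypothesis faces : forall S, S \in cliques e q.+1 ->
   (density e S - (1 - q.+1%:R * beta)) * (beta - density e S) = 0.
Hypothesis sum_faces : \sum_(x in T) density e (T :\ x) = 2 - q.+2%:R * beta.

Definition full_face x := (x \in T) && (density e (T :\ x) == beta).

(* The faces sum to [(q+2) beta - 2 s] with [s = density_gap]; each non-full face loses exactly [s]. *)
Lemma full_faces_card : (q <= #|[set x | full_face x]|)%N.
Proof.
set B := [set x | full_face x].
have BT : B \subset T by apply/subsetP => x; rewrite inE => /andP[].
set s := q.+2%:R * beta - 1.
have fE x : x \in T -> density e (T :\ x) = beta - s * (x \notin B)%:R.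
  move=> xT; rewrite inE /full_face xT /=.
  have [S1 _] := cliquesD1 eG TK xT; move/eqP: (faces S1).
  rewrite mulf_eq0 !subr_eq0 => /orP[/eqP E|/eqP <-]; last by rewrite eqxx mulr0 subr0.
  case: eqP => [->|_]; first by rewrite mulr0 subr0.
  by rewrite E /s -(natr1 q.+1) mulr1; ring.
have E : \sum_(x in T) density e (T :\ x) = q.+2%:R * beta - s * #|T :\: B|%:R.
  rewrite (eq_bigr _ fE) sumrB sumr_const (cliques_card TK) -(mulr_natl beta).
  congr (_ - _); rewrite -mulr_sumr; congr (_ * _).
  rewrite -sum1_card natr_sum big_mkcond [RHS]big_mkcond /=; apply: eq_bigr => x _.
  by rewrite !inE andbC; case: (x \in T) => //=; case: (full_face x).
rewrite sum_faces in E.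
have cB := cardsID B T; rewrite (setIidPr BT) (cliques_card TK) in cB.
have [s0|s0] := eqVneq s 0; last first.
  have : (2 - #|T :\: B|%:R) * s = 0 by rewrite /s in E *; lra.
  move/eqP; rewrite mulf_eq0 (negbTE s0) orbF subr_eq0 (eqr_nat rat 2) => /eqP E2.
  by move: cB; rewrite -E2 addn2 => -[->].
have -> : B = T.
  apply/eqP; rewrite eqEsubset BT; apply/subsetP => x xT.
  by rewrite inE /full_face xT fE // s0 mul0r subr0 eqxx.
by rewrite (cliques_card TK) ltnW.
Qed.

(** A neighbour of v in this common neighbourhood would extend T to a K_(p+2); both sides have beta
    n elements. *)
Lemma full_face_nonnbh v : full_face v -> common e (T :\ v) = ~: nbh e v.
Proof.
case/andP => vT /eqP D; apply/eqP; rewrite eqEcard; apply/andP; split.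
  apply/subsetP => y yc; rewrite !inE; apply/negP => evy.
  have := no_big (y |: T); rewrite in_cliquesU1 ?TK //=; last first.
    apply/negP => yT; move: yc; rewrite in_common // => /forall_inP.
    case: (eqVneq y v) => [yv|yv]; first by rewrite yv adj_irr in evy.
    by move/(_ y); rewrite !inE yv yT adj_irr // => /(_ isT).
  by rewrite -(setD1K vT) commonU1 // inE yc inE evy.
rewrite -(ler_nat rat) card_nonnbh -D /density divfK //; exact: N_neq0.
Qed.

Lemma extremal_structure :
  exists part, multipartite part /\ triangles e [set x | part x == 0%N] = 0%N.
Proof.
(* More than q faces can be full, for instance all q + 2 when the density gap is 0. Exactly q of
   them yield V_1, ..., V_q, and V_0 takes the remaining vertices. *)
pose s := take q (enum [set x | full_face x]).
have ss : size s = q by rewrite size_takel // -cardE full_faces_card.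
have us : uniq s by rewrite take_uniq // enum_uniq.
have fs v : v \in s -> full_face v.
  by move/mem_take; rewrite mem_enum inE.
have sT v : v \in s -> v \in T by move/fs/andP => [].
(* The value is [size s] = q when y is adjacent to every vertex of s; such y form part 0. *)
pose i0 y := find (fun v => ~~ e v y) s.
pose part y := if (i0 y < q)%N then (i0 y).+1 else 0%N.
(* The non-neighbourhood of v is the common neighbourhood of T :\ v, hence lies inside the
   neighbourhood of any other v'. *)
have disj v v' y : v \in s -> v' \in s -> ~~ e v y -> ~~ e v' y -> v = v'.
  move=> vs v's evy; apply: contraNeq => vv'.
  have : y \in common e (T :\ v) by rewrite full_face_nonnbh ?fs // !inE.
  by move/common_adj; apply => //; rewrite !inE eq_sym vv' sT.
have partS y i : (i < q)%N -> (part y == i.+1) = ~~ e (nth y s i) y.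
  move=> iq; apply/idP/idP.
    rewrite /part; case: ifP => // h; rewrite eqSS => /eqP <-.
    by apply: (@nth_find _ _ (fun v => ~~ e v y)); rewrite has_find ss.
  move=> ne; have h : has (fun v => ~~ e v y) s.
    by apply/hasP; exists (nth y s i) => //; rewrite mem_nth ?ss.
  have h2 : (i0 y < q)%N by rewrite -ss -has_find.
  rewrite /part h2 eqSS -(nth_uniq y _ _ us) ?ss //.
  by apply/eqP; apply: (disj _ _ y); rewrite ?mem_nth ?ss // (nth_find y h).
have cls i : (i < q)%N -> exists2 v, v \in s & [set x | part x == i.+1] = ~: nbh e v.
  move=> iq; have [x0 _] : exists x0 : 'I_n, true by exists (Ordinal n0).
  exists (nth x0 s i); first by rewrite mem_nth ?ss.
  by apply/setP => y; rewrite !inE partS // (set_nth_default x0 y) ?ss.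
have lt x : (part x < q.+1)%N by rewrite /part; case: ifP.
have indep x y v : v \in s -> ~~ e v x -> ~~ e v y -> ~~ e x y.
  move=> vs vx vy; apply/negP => exy.
  have [S1 _] := cliquesD1 eG TK (sT v vs).
  have xc : x \in common e (T :\ v) by rewrite full_face_nonnbh ?fs // !inE.
  have yc : y \in common e (T :\ v) by rewrite full_face_nonnbh ?fs // !inE.
  have x1 : x |: (T :\ v) \in cliques e q.+2.
    by rewrite in_cliquesU1 ?(common_notin eG xc) // S1.
  have yc2 : y \in common e (x |: (T :\ v)) by rewrite commonU1 // inE yc inE exy.
  have := no_big (y |: (x |: (T :\ v))).
  by rewrite in_cliquesU1 ?(common_notin eG yc2) // x1 yc2.
(* By [indep] the class of v lies in the non-neighbourhood of x, and by regularity both have beta n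
   elements. So x is joined to everything outside its class. *)
have full x v : v \in s -> ~~ e v x -> nbh e x = nbh e v.
  move=> vs vx; apply: setC_inj; apply/eqP; rewrite eq_sym eqEcard.
  rewrite -(ler_nat rat) !card_nonnbh lexx andbT.
  by apply/subsetP => y; rewrite !inE; exact: indep vs vx.
have cross0 x y : part y != 0%N -> part x != part y -> e x y.
  move=> py; have := lt y; case E : (part y) py => [//|i] _; rewrite ltnS => iq.
  have [v vs C] := cls i iq; move=> px.
  have : y \in ~: nbh e v by rewrite -C inE E.
  have : x \notin ~: nbh e v by rewrite -C inE.
  rewrite !inE negbK => vx vy; have := full y v vs vy => /setP/(_ x).
  by rewrite !inE vx (adj_sym eG).
have M : multipartite part.
  split=> //.
  - case=> // i /= iq; have [v _ ->] := cls i iq; exact: card_nonnbh.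
  - move=> x y xy; have [y0|y0] := eqVneq (part y) 0%N; last exact: cross0.
    by rewrite (adj_sym eG); apply: cross0; rewrite -?y0 // eq_sym.
  - move=> x y; have := lt x; case E : (part x) => [//|i]; rewrite ltnS => iq Ey _.
    have [v vs C] := cls i iq; apply: (indep _ _ v vs).
      by have : x \in ~: nbh e v; [rewrite -C inE E | rewrite !inE].
    by have : y \in ~: nbh e v; [rewrite -C inE -Ey | rewrite !inE].
exists part; split=> //; case: M => _ _ cross _.
apply/eqP; rewrite /triangles cards_eq0; apply/eqP/setP => A; rewrite !inE.
apply/negP => /and3P[A0 /eqP A3 Acl].
have sp v : v \in s -> part v != 0%N.
  move=> vs; have hi : (index v s < q)%N by rewrite -ss index_mem.
  have := partS v _ hi; rewrite nth_index // adj_irr // => /eqP ->; exact: isT.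
have Apart x : x \in A -> part x = 0%N.
  by move=> xA; move/subsetP: A0 => /(_ x xA); rewrite inE => /eqP.
(* A triangle in V_0 is completely joined to the q pairwise adjacent vertices of s and would give a
   clique of size q + 3 = p + 2. *)
pose Q := A :|: [set v in s].
have dis : A :&: [set v in s] = set0.
  apply/setP => v; rewrite !inE; apply/negP => /andP[vA vs].
  by move: (sp v vs); rewrite Apart.
have := no_big Q; rewrite inE cardsU dis cards0 subn0 A3 cardsE (card_uniqP us) ss.
rewrite (_ : 3 + q = q.+3)%N // eqxx /= => /cliqueP; apply => x y.
rewrite !inE => /orP[xA|xs] /orP[yA|ys] xy.
- by move/cliqueP: Acl; apply.
- by apply: cross; rewrite Apart // eq_sym sp.
- by apply: cross; rewrite (Apart y) // sp.
- by move/cliques_clique/cliqueP: TK; apply => //; exact: sT.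
Qed.

End Structure.

(** * Clique densities of the extremal graphs *)

Section FamilyCount.
Variables (n : nat) (e : rel 'I_n) (beta : rat) (q : nat) (part : 'I_n -> nat).
Hypotheses (eG : simple_graph e) (n0 : (0 < n)%N).
Hypothesis M : multipartite e beta q part.
Let V0 := [set x | part x == 0%N].
Hypothesis deg0 : forall x, x \in V0 ->
  (#|[set y in V0 | e x y]|%:R : rat) = (1 - q.+1%:R * beta) * n%:R.
Implicit Types (S T A : {set 'I_n}) (x y : 'I_n).
Local Notation N := (n%:R : rat).
Local Notation kap := (clique_density e).
Local Notation avg := (clique_avg e).
Local Notation dens := (density e).
Local Notation cliques := (cliques e).
Local Notation common := (common e).

Let cross x y : part x != part y -> e x y. Proof. by case: M => _ _ + _; apply. Qed.
Let indep x y : part x = part y -> part x != 0%N -> ~~ e x y.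
Proof. by case: M => _ _ _; apply. Qed.

Lemma family_card0C : #|~: V0|%:R = q%:R * beta * N :> rat.
Proof.
have := cardsC V0; rewrite card_ord => /(congr1 (fun k => k%:R : rat)).
rewrite natrD (multipartite_card0 M); lra.
Qed.

Lemma family_deg x : (deg e x)%:R = (1 - beta) * N.
Proof.
rewrite -card_nbh; have [x0|x0] := boolP (x \in V0).
  rewrite -(cardsID V0 (nbh e x)) natrD.
  have -> : nbh e x :&: V0 = [set y in V0 | e x y].
    by apply/setP => y; rewrite !inE andbC.
  have -> : nbh e x :\: V0 = ~: V0.
    apply/setP => y; rewrite !inE; case: eqP => //= /eqP ny.
    by rewrite cross //; move: x0; rewrite inE => /eqP ->; rewrite eq_sym.
  by rewrite deg0 // family_card0C -(natr1 q); ring.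
have -> : nbh e x = ~: [set y | part y == part x].
  apply/setP => y; rewrite !inE; have [E|E] := eqVneq (part y) (part x).
    by rewrite (negbTE (indep _ _)) //; move: x0; rewrite inE.
  by rewrite cross // eq_sym.
have := cardsC [set y | part y == part x].
rewrite card_ord => /(congr1 (fun k => k%:R : rat)); rewrite natrD.
case: (M) => lt sz _ _; rewrite sz; first lra.
by rewrite lt andbT lt0n; move: x0; rewrite inE.
Qed.

Hypothesis tri0 : triangles e V0 = 0%N.

Lemma family_triangle A : A \subset V0 -> #|A| = 3 -> ~~ is_clique e A.
Proof.
move=> A0 A3; apply/negP => Acl.
have : A \in [set T : {set 'I_n} | [&& T \subset V0, #|T| == 3%N & is_clique e T]].
  by rewrite inE A0 A3 eqxx Acl.
by move/eqP: tri0; rewrite /triangles cards_eq0 => /eqP ->; rewrite inE.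
Qed.

Lemma family_clique0 S : is_clique e S -> (#|S :&: V0| <= 2)%N.
Proof.
move=> Scl; rewrite leqNgt; apply/negP => /card_geqP[s [us ss sub]].
have sS : [set x in s] \subset S :&: V0.
  by apply/subsetP => x; rewrite inE => /sub.
have c3 : #|[set x in s]| = 3 by rewrite cardsE (card_uniqP us).
have := family_triangle (subset_trans sS (subsetIr _ _)) c3.
by rewrite (cliqueS (subset_trans sS (subsetIl _ _)) Scl).
Qed.

(** Two vertices of S missed by y would lie in the part of y; being adjacent they would be in V_0,
    and y with them. Thus y misses at most one vertex, and the indicator of full adjacency is
    exactly [jn] - t, which makes the density computable from degrees. *)
Lemma family_jn S y t : S \in cliques t.+1 ->
  (y \notin V0) || (#|S :&: V0| <= 1)%N -> (t <= jn e S y)%N.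
Proof.
move=> St hy; have cS := cliques_card St.
have : (#|S :\: nbh e y| <= 1)%N.
  apply/card_le1_eqP => x z; rewrite !inE => /andP[yx xS] /andP[yz zS].
  have px : part x = part y.
    by apply/eqP; apply: contraNT yx => ne; rewrite cross // eq_sym.
  have pz : part z = part y.
    by apply/eqP; apply: contraNT yz => ne; rewrite cross // eq_sym.
  apply/eqP; apply/negPn/negP => xz.
  have /cliqueP clS := cliques_clique St.
  have exz : e x z by apply: clS xS zS _; rewrite eq_sym.
  have p0 : part x = 0%N.
    by apply/eqP; apply: contraTT exz => p0; apply: indep => //; rewrite px pz.
  case/orP: hy => [|/card_le1_eqP/(_ x z)]; first by rewrite inE -px p0.
  move=> E; case/negP: xz; apply/eqP; apply: E; rewrite !inE ?xS ?zS /=.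
    by rewrite p0.
  by rewrite pz -px p0.
by rewrite /jn -(leq_add2l (#|S :&: nbh e y|)) cardsID cS addn1 ltnS.
Qed.

Lemma family_dens S t : S \in cliques t.+1 ->
  dens S = low_density beta t.+1 + density_gap beta q.+1 * (#|S :&: V0| == 2%N)%:R.
Proof.
move=> St; have cS := cliques_card St.
have N0 := N_neq0 n0.
have jnE y : (y \notin V0) || (#|S :&: V0| <= 1)%N ->
  (jn e S y == #|S|)%:R = (jn e S y)%:R - t%:R :> rat.
  move=> hy; have := family_jn St hy; have := jn_le e S y; rewrite cS => h1 h2.
  have [->|ne] := eqVneq (jn e S y) t.+1; first by rewrite -(natr1 t) /=; ring.
  have -> : jn e S y = t by lia.
  by rewrite subrr.
have sumd : \sum_(x in S) (deg e x)%:R = t.+1%:R * ((1 - beta) * N) :> rat.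
  rewrite (eq_bigr (fun=> (1 - beta) * N)) => [|x _]; last exact: family_deg.
  by rewrite sumr_const cS -(mulr_natl ((1 - beta) * N)).
apply: (mulIf N0); rewrite divfK // card_common //.
have [S2|S2] := eqVneq #|S :&: V0| 2%N; last first.
  have S1 : (#|S :&: V0| <= 1)%N.
    have := family_clique0 (cliques_clique St); move: S2; lia.
  rewrite (eq_bigr (fun y => (jn e S y)%:R - t%:R)) => [|y _]; last first.
    by apply: jnE; rewrite S1 orbT.
  rewrite sumrB (sum_jn eG) sumd sumr_const card_ord -(mulr_natl t%:R).
  by rewrite /low_density -(natr1 t) mulr0n; ring.
(* When S has two vertices in V_0, a common neighbour in V_0 would complete a triangle there, so
   only y outside V_0 contribute. *)
rewrite (bigID (mem V0)) /= [X in X + _]big1 ?add0r => [|y y0]; last first.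
  rewrite -common_jn; apply/eqP; rewrite pnatr_eq0 eqb0; apply/negP => yc.
  have : y |: (S :&: V0) \subset V0.
    by apply/subsetP => x; rewrite inE => /orP[|]; rewrite inE; [move/eqP->|case/andP].
  have yn : y \notin S :&: V0 by rewrite inE negb_and (common_notin eG yc).
  move/family_triangle; rewrite cardsU1 yn S2 => /(_ erefl)/negP; apply.
  rewrite cliqueU1 // (cliqueS (subsetIl _ _) (cliques_clique St)) /=.
  by move: yc; apply/subsetP; apply: commonS; exact: subsetIl.
rewrite (eq_bigr (fun y => (jn e S y)%:R - t%:R)) => [|y y0]; last first.
  by apply: jnE; rewrite y0.
have CE (F : 'I_n -> rat) : \sum_(y | y \notin V0) F y = \sum_(y in ~: V0) F y.
  by apply: eq_bigl => y; rewrite !inE.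
rewrite CE sumrB (sum_jn_in eG) sumr_const -(mulr_natl t%:R) family_card0C.
have E x : x \in S -> #|nbh e x :&: ~: V0|%:R =
    (q%:R - 1) * beta * N + beta * N * (x \in V0)%:R :> rat.
  move=> xS; have [x0|x0] := boolP (x \in V0); rewrite ?mulr1 ?mulr0 ?addr0.
    have -> : nbh e x :&: ~: V0 = ~: V0.
      apply/setIidPr/subsetP => y; rewrite !inE => ny.
      by rewrite cross //; move: x0; rewrite inE => /eqP ->; rewrite eq_sym.
    by rewrite family_card0C; ring.
  have := cardsID V0 (nbh e x) => /(congr1 (fun k => k%:R : rat)).
  have -> : nbh e x :&: V0 = V0.
    apply/setIidPr/subsetP => y y0; rewrite inE cross //.
    by move: x0 y0; rewrite !inE => x0 /eqP ->.
  rewrite natrD (multipartite_card0 M) setDE card_nbh family_deg; lra.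
rewrite (eq_bigr _ E) big_split /= sumr_const cS -mulr_sumr -(mulr_natl ((q%:R - 1) * beta * N)).
have -> : \sum_(x in S) (x \in V0)%:R = 2 :> rat.
  rewrite -S2 -sum1_card natr_sum big_mkcond [RHS]big_mkcond /=; apply: eq_bigr => x _.
  by rewrite [x \in S :&: V0]inE; case: (x \in S); case: (x \in V0).
rewrite /low_density /density_gap -(natr1 t) -(natr1 q.+1) -(natr1 q); ring.
Qed.

Let type2 S := (#|S :&: V0| == 2%N)%:R : rat.

Lemma avg_cliques1 (F : {set 'I_n} -> rat) : avg 1 F = (\sum_x F [set x]) / N.
Proof.
transitivity (avg 1 (fun T => \sum_(x in T) F T)).
  apply: eq_avg => T T1; rewrite sumr_const (cliques_card T1) //.
rewrite -(avg_ext eG) /clique_avg expr0 divr1.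
have -> : cliques 0 = [set set0].
  apply/setP => S; rewrite !inE cards_eq0; case: eqP => //= ->.
  by apply/cliqueP => x y; rewrite inE.
rewrite big_set1; congr (_ / _); apply: eq_big => x.
  by rewrite in_common //; apply/forall_inP => y; rewrite inE.
by rewrite setU0.
Qed.

Lemma family_type2_2 : avg 2 type2 = hp q beta 2.
Proof.
have N0 := N_neq0 n0.
have : avg 2 (fun T => \sum_(x in T) type2 T) = 2 * avg 2 type2.
  rewrite -avgZ; apply: eq_avg => T T2.
  by rewrite sumr_const (cliques_card T2) -(mulr_natl (type2 T)).
rewrite -(avg_ext eG) avg_cliques1 => E.
have {}E : 2 * avg 2 type2 = (1 - q.+1%:R * beta) * (1 - q%:R * beta).
  rewrite -E.
  rewrite (eq_bigr (fun v => (1 - q.+1%:R * beta) * (v \in V0)%:R)) => [|v _].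
    rewrite -mulr_sumr -card_set_sum.
    have -> : #|[set y | y \in V0]|%:R = (1 - q%:R * beta) * N.
      by rewrite -(multipartite_card0 M); congr (_%:R); apply: eq_card => y; rewrite !inE.
    by rewrite mulrA mulfK.
  have [v0|v0] := boolP (v \in V0); last first.
    rewrite mulr0 big1 ?mul0r // => x _; rewrite /type2.
    have : (#|(x |: [set v]) :&: V0| <= #|[set x]|)%N.
      apply: subset_leq_card; apply/subsetP => y; rewrite !inE.
      case/andP => /orP[//|/eqP ->] v00; by move: v0; rewrite inE v00.
    by rewrite cards1; case: eqP => // ->.
  rewrite mulr1; apply: (mulIf N0); rewrite divfK // -(deg0 v0).
  rewrite -sum1_card natr_sum big_mkcond [RHS]big_mkcond /=; apply: eq_bigr => x _.
  have -> : (x \in common [set v]) = e v x.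
    rewrite in_common //; apply/forall_inP/idP => [->//|evx y]; first by rewrite inE.
    by rewrite inE => /eqP ->.
  rewrite !inE andbC; case: (boolP (e v x)) => //= evx; rewrite /type2.
  have xv : x \notin [set v].
    by rewrite inE; apply: contraTneq evx => ->; rewrite (adj_irr eG).
  case: ifP => x0.
    have -> : (x |: [set v]) :&: V0 = x |: [set v].
      apply/setIidPl/subsetP => y; rewrite !inE => /orP[/eqP->|/eqP->]; first by rewrite x0.
      by move: v0; rewrite inE.
    by rewrite cardsU1 xv cards1.
  have : (#|(x |: [set v]) :&: V0| <= #|[set v]|)%N.
    apply: subset_leq_card; apply/subsetP => y; rewrite !inE.
    by case/andP => /orP[/eqP->|//]; rewrite x0.
  by rewrite cards1; case: eqP => // ->.
rewrite /hp subnn bin0 expr0; lra.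
Qed.

(** Removals are counted only at vertices outside V_0: there are t - 1 of them, they keep the two
    vertices in V_0, and conversely every extension of such a clique is by a vertex outside V_0. *)
Lemma family_type2S t : (2 <= t)%N ->
  (t%:R - 1) * avg t.+1 type2 = high_density beta q.+1 t * avg t type2.
Proof.
move=> t2; rewrite -!avgZ.
transitivity (avg t.+1 (fun T => \sum_(x in T) type2 T * (x \notin V0)%:R)).
  apply: eq_avg => T Tt; rewrite -mulr_sumr [LHS]mulrC /type2.
  have [T2|] := eqVneq; last by rewrite !mul0r.
  congr (_ * _); have := cardsID V0 T; rewrite (cliques_card Tt) T2 => E.
  have -> : t%:R - 1 = #|T :\: V0|%:R :> rat.
    have : (2 + #|T :\: V0|)%:R = t.+1%:R :> rat by rewrite E.
    by rewrite natrD -(natr1 t); lra.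
  rewrite -sum1_card natr_sum big_mkcond [RHS]big_mkcond /=; apply: eq_bigr => x _.
  by rewrite [x \in T :\: V0]inE andbC; case: (x \in T) => //=; case: (x \in V0).
rewrite -(avg_ext eG); apply: eq_avg => S St.
have [t' tE] : exists t', t = t'.+1 by case: (t) t2 => // k _; exists k.
rewrite /type2; have [S2|S2] := eqVneq #|S :&: V0| 2%N; last first.
  rewrite mulr0 big1 ?mul0r // => x xc; case: (boolP (x \in V0)) => x0; rewrite ?mulr0 //.
  have -> : (x |: S) :&: V0 = S :&: V0.
    apply/setP => y; rewrite !inE; case: eqVneq => //= ->.
    by move: x0; rewrite inE => /negbTE->; rewrite andbF.
  by rewrite (negbTE S2) mul0r.
rewrite mulr1 bcE; rewrite tE in St *; have := family_dens St.
rewrite S2 eqxx mulr1 => <-; rewrite /density; congr (_ / _).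
rewrite -sum1_card natr_sum; apply: eq_bigr => x xc.
have x0 : x \notin V0.
  apply/negP => x0.
  have := @family_clique0 (x |: S); rewrite cliqueU1 ?(common_notin eG xc) // xc.
  rewrite (cliques_clique St) => /(_ isT).
  have -> : (x |: S) :&: V0 = x |: (S :&: V0).
    by apply/setP => y; rewrite !inE; case: eqVneq => //= ->; move: x0; rewrite inE.
  by rewrite cardsU1 S2 inE (negbTE (common_notin eG xc)).
have -> : (x |: S) :&: V0 = S :&: V0.
  apply/setP => y; rewrite !inE; case: eqVneq => //= ->.
  by move: x0; rewrite inE => /negbTE->; rewrite andbF.
by rewrite S2 x0 mulr1.
Qed.

Lemma family_kapS t : (1 <= t)%N ->
  t.+1%:R * kap t.+1 = low_density beta t * kap t + density_gap beta q.+1 * avg t type2.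
Proof.
case: t => // t _; rewrite -(avg_dens eG) -avgC -avgZ -avgD.
by apply: eq_avg => S St; rewrite (family_dens St).
Qed.

(** The pair of densities obeys the recursions [gp_rec] and [hp_rec] with the same values at t =
    2. *)
Lemma family_kap t : (2 <= t)%N -> kap t = gp q beta t.
Proof.
move=> t2; suff [] : kap t = gp q beta t /\ avg t type2 = hp q beta t by [].
elim: t t2 => // t IH; rewrite leq_eqVlt => /orP[/eqP[<-]|].
  split; last exact: family_type2_2.
  have := family_kapS (leqnn 1); rewrite (kap1 e n0) gp2 avg_cliques1 big1 ?mul0r.
    by rewrite /low_density; lra.
  move=> x _; rewrite /type2; have : (#|[set x] :&: V0| <= 1)%N.
    by rewrite -(cards1 x) subset_leq_card // subsetIl.
  by case: eqP => // ->.
rewrite ltnS => t2; have [E1 E2] := IH t2; split.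
  apply: (mulfI (_ : t.+1%:R != 0)); first by rewrite pnatr_eq0.
  by rewrite family_kapS ?(ltnW t2) // E1 E2 gp_rec.
have t1 : t%:R - 1 != 0 :> rat by rewrite subr_eq0 (eqr_nat rat t 1) gtn_eqF.
by apply: (mulfI t1); rewrite family_type2S // hp_rec // E2.
Qed.

End FamilyCount.

(** * Existence of regular graphs and of those with fewest triangles *)

Lemma card_ord_interval m a b : (a <= b <= m)%N ->
  #|[set i : 'I_m | (a <= i < b)%N]| = (b - a)%N.
Proof.
case/andP => ab bm; rewrite -sum1_card.
rewrite (eq_bigl (fun i : 'I_m => (a <= i < b)%N)) => [|i]; last by rewrite inE.
rewrite -(big_mkord (fun i => (a <= i < b)%N) (fun=> 1%N)).
rewrite -[RHS]muln1 -sum_nat_const_nat (big_nat_widen _ _ _ _ _ bm) [RHS](big_nat_widenl _ 0) //.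
by apply: eq_bigl => i; rewrite andbC.
Qed.

Definition regular (m : nat) (e : rel 'I_m) (d : nat) : Prop :=
  simple_graph e /\ forall x, deg e x = d.

(* The interval [l, m+1-l], punctured at its midpoint when the parity of [d] requires it. *)
Lemma symmetric_set_exists m d : (d <= m)%N -> ~~ (odd m.+1 && odd d) ->
  exists C : {set 'I_m.+1}, [/\ 0 \notin C, forall i, (- i \in C) = (i \in C) & #|C| = d].
Proof.
move=> dm par; set k := (m.+1 - d)%N; set l := uphalf k.
have l0 : (0 < l)%N by rewrite /l /k; lia.
pose I := [set i : 'I_m.+1 | (l <= i < (m.+1 - l).+1)%N].
have negE (i : 'I_m.+1) : (0 < i)%N -> val (- i) = (m.+1 - i)%N.
  by move=> i0 /=; rewrite modn_small //; lia.
have I0 : 0 \notin I by rewrite inE /= leqNgt l0.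
have Isym (i : 'I_m.+1) : i \in I -> - i \in I.
  rewrite !inE => /andP[h1 h2]; rewrite negE ?(leq_trans l0) //; lia.
have Icard : #|I| = ((m.+1 - l).+1 - l)%N.
  by rewrite card_ord_interval //; rewrite /l /k; lia.
have sym (C : {set 'I_m.+1}) : (forall i, i \in C -> - i \in C) ->
    forall i, (- i \in C) = (i \in C).
  by move=> h i; apply/idP/idP => [/h|/h //]; rewrite opprK.
have [ok|ek] := boolP (odd k).
  exists I; split=> //; first exact: sym.
  by rewrite Icard /l /k in ok *; lia.
have hm : ((m.+1)./2 < m.+1)%N by lia.
pose mid := Ordinal hm.
have modd : (m.+1 = (m.+1)./2 + (m.+1)./2)%N by move: ek par; rewrite /k; lia.
have m0 : (0 < mid)%N by rewrite /=; lia.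
exists (I :\ mid); split.
- by rewrite inE negb_and I0 orbT.
- apply: sym => i; rewrite !in_setD1 => /andP[ne iI]; rewrite Isym // andbT.
  apply: contraNneq ne => E; rewrite -(opprK i) E; apply/eqP/val_inj.
  by rewrite negE //=; lia.
- have midI : mid \in I by rewrite inE /= /l /k; move: ek par; rewrite /k; lia.
  apply: (@addnI 1); have := cardsD1 mid I; rewrite midI => <-; rewrite Icard.
  by move: ek par; rewrite /l /k; lia.
Qed.

(** A circulant graph: x and y are joined when y - x, taken modulo m, lies in a symmetric set of d
    nonzero residues. *)
Lemma regular_exists m d : (d < m)%N -> ~~ (odd m && odd d) ->
  exists e : rel 'I_m, regular e d.
Proof.
case: m => // m dm par; have [C [C0 Csym Cd]] := @symmetric_set_exists m d dm par.
exists (fun x y => y - x \in C); split.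
  split; first by move=> x; rewrite subrr; exact: negbTE.
  by move=> x y; rewrite -Csym opprB.
move=> x; rewrite /deg -Cd -(card_imset C (addrI x)); apply: eq_card => y.
rewrite inE; apply/idP/imsetP => [yC|[z zC ->]]; last by rewrite addrC addKr.
by exists (y - x) => //; rewrite addrC subrK.
Qed.

(** The conditions on f are restricted to S, so that f may be a map such as [inord], whose values
    are meaningful only there. *)
Lemma triangles_map n m (e : rel 'I_n) (e' : rel 'I_m) (S : {set 'I_n}) (S' : {set 'I_m})
    (f : 'I_n -> 'I_m) :
  {in S &, injective f} -> (forall x, x \in S -> f x \in S') ->
  (forall x y, x \in S -> y \in S -> e x y -> e' (f x) (f y)) ->
  (triangles e S <= triangles e' S')%N.
Proof.
move=> inj fS fe; rewrite /triangles.
set X := [set T : {set 'I_n} | _]; set X' := [set T : {set 'I_m} | _].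
have injX : {in X &, injective (fun A : {set 'I_n} => f @: A)}.
  move=> A B; rewrite !inE => /and3P[AS _ _] /and3P[BS _ _] E.
  have sub (A1 B1 : {set 'I_n}) : A1 \subset S -> B1 \subset S ->
      f @: A1 = f @: B1 -> A1 \subset B1.
    move=> /subsetP A1S /subsetP B1S E1; apply/subsetP => x xA.
    have : f x \in f @: B1 by rewrite -E1 imset_f.
    by case/imsetP => y yB /(inj _ _ (A1S _ xA) (B1S _ yB)) ->.
  by apply/eqP; rewrite eqEsubset (sub _ _ AS BS E) (sub _ _ BS AS (esym E)).
rewrite -(card_in_imset injX); apply: subset_leq_card; apply/subsetP => _ /imsetP[A + ->].
rewrite !inE => /and3P[AS /eqP A3 /cliqueP Acl].
have injA : {in A &, injective f}.
  by move=> x y xA yA; apply: inj; exact: (subsetP AS).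
rewrite card_in_imset // A3 eqxx /=; apply/andP; split.
  by apply/subsetP => _ /imsetP[x xA ->]; apply: fS; exact: (subsetP AS).
apply/cliqueP => _ _ /imsetP[x xA ->] /imsetP[y yA ->] xy.
apply: fe; try exact: (subsetP AS).
by apply: Acl => //; apply: contraNneq xy => ->.
Qed.

(** Relations are encoded as sets of pairs, which form a finite type over which a minimum can be
    taken. *)
Lemma min_triangles_exists m d (e1 : rel 'I_m) : regular e1 d ->
  exists e0 : rel 'I_m, regular e0 d /\
    forall e' : rel 'I_m, regular e' d ->
      (@triangles m e0 setT <= @triangles m e' setT)%N.
Proof.
pose R (E : {set 'I_m * 'I_m}) : rel 'I_m := fun x y => (x, y) \in E.
pose P (E : {set 'I_m * 'I_m}) :=
  [&& [forall x, ~~ R E x x], [forall x, forall y, R E x y == R E y x] &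
      [forall x, deg (R E) x == d]].
have PP E : reflect (regular (R E) d) (P E).
  apply: (iffP and3P) => [[/forallP h1 /forallP h2 /forallP h3]|[[h1 h2] h3]].
    split; [split|] => [x|x y|x]; [exact: negbTE| |exact/eqP].
    by move/forallP: (h2 x) => /(_ y)/eqP.
  split; [apply/forallP => x|apply/forallP => x; apply/forallP => y|apply/forallP => x].
  - by rewrite h1.
  - by rewrite h2.
  - by rewrite h3.
pose E_ (e : rel 'I_m) := [set z : 'I_m * 'I_m | e z.1 z.2].
have RE e x y : R (E_ e) x y = e x y by rewrite /R inE.
have reg e : regular e d -> P (E_ e).
  case=> [[h1 h2] h3]; apply/PP; split; [split|] => [x|x y|x].
  - by rewrite RE h1.
  - by rewrite !RE h2.
  - by rewrite -(h3 x); apply: eq_card => y; rewrite !inE.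
move=> r1; have P1 := reg _ r1.
case: (arg_minnP (fun E => triangles (R E) setT) P1) => E0 P0 mn.
exists (R E0); split; first exact/PP.
move=> e' r'; apply: leq_trans (mn _ (reg _ r')) _.
by apply: (triangles_map (f := id)) => // x y _ _; rewrite RE.
Qed.

Lemma induced_regular n (e : rel 'I_n) (V : {set 'I_n}) : simple_graph e ->
  let e' := fun i j : 'I_#|V| => e (enum_val i) (enum_val j) in
  simple_graph e' /\ forall i, deg e' i = #|[set y in V | e (enum_val i) y]|.
Proof.
move=> [h1 h2] e'; split; first by split=> [i|i j]; [exact: h1 | exact: h2].
move=> i; rewrite /deg -(card_imset _ (@enum_val_inj _ (mem V))).
apply: eq_card => y; rewrite !inE; apply/imsetP/andP => [[j]|[yV exy]].
  by rewrite inE => ej ->; rewrite enum_valP.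
exists (enum_rank_in yV y); last by rewrite enum_rankK_in.
by rewrite inE /e' enum_rankK_in.
Qed.

(** * Joining a regular graph completely to q independent blocks of size B *)

Section BlowUp.
Variables (m q B : nat) (e0 : rel 'I_m.+1) (d : nat).
Hypotheses (B0 : (0 < B)%N) (e0R : regular e0 d).
Let n := (m.+1 + q * B)%N.

Definition blow_part (x : 'I_n) : nat :=
  if (x < m.+1)%N then 0%N else ((x - m.+1) %/ B).+1.
Definition blow_up : rel 'I_n := fun x y =>
  (blow_part x != blow_part y) ||
  (blow_part x == 0%N) && e0 (inord x) (inord y).

Lemma blow_part0 x : (blow_part x == 0%N) = (x < m.+1)%N.
Proof. by rewrite /blow_part; case: ifP. Qed.

Lemma blow_up_simple : simple_graph blow_up.
Proof.
case: e0R => [[h1 h2] _]; split=> [x|x y]; rewrite /blow_up.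
  by rewrite eqxx h1 andbF.
by rewrite eq_sym; case: eqVneq => //= ->; rewrite h2.
Qed.

Lemma blow_up_multipartite (beta : rat) : beta * n%:R = B%:R ->
  multipartite blow_up beta q blow_part.
Proof.
move=> bE; split.
- move=> x; rewrite /blow_part; case: ifP => // h; rewrite ltnS ltn_divLR //.
  by rewrite ltn_subLR ?ltn_ord // leqNgt h.
- case=> // i /=; rewrite ltnS => iq; rewrite bE; congr (_%:R).
  have -> : [set x | blow_part x == i.+1] =
      [set x : 'I_n | (m.+1 + i * B <= x < m.+1 + i.+1 * B)%N].
    apply/setP => x; rewrite !inE /blow_part; case: ltnP => h; first by lia.
    rewrite eqSS eqn_leq leq_divRL // -ltnS ltn_divLR //; lia.
  rewrite card_ord_interval; first lia.
  by rewrite /n !leq_add2l !leq_mul2r iq leqnSn !orbT.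
- by move=> x y xy; rewrite /blow_up xy.
- by move=> x y E y0; rewrite /blow_up (negbTE y0) E eqxx.
Qed.

Lemma blow_up_deg0 x : x \in [set z | blow_part z == 0%N] ->
  #|[set y in [set z | blow_part z == 0%N] | blow_up x y]| = d.
Proof.
rewrite inE => x0; case: e0R => _ /(_ (inord x)) <-.
have le : (m.+1 <= n)%N by rewrite leq_addr.
have inj : injective (widen_ord le) by move=> i j /(congr1 val) /= /val_inj.
rewrite /deg -(card_imset _ inj); apply: eq_card => y; rewrite !inE.
apply/andP/imsetP => [[y0]|[j]].
  rewrite /blow_up (eqP x0) (eqP y0) eqxx /= => ex.
  exists (inord y); first by rewrite inE.
  by apply: val_inj; rewrite /= inordK // -blow_part0.
rewrite inE => ej ->; have j0 : blow_part (widen_ord le j) == 0%N by rewrite blow_part0 /=.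
split=> //; rewrite /blow_up (eqP x0) (eqP j0) eqxx /= .
by have -> : inord j = j by apply: val_inj; rewrite /= inordK.
Qed.

Lemma blow_up_triangles :
  (triangles blow_up [set z | blow_part z == 0%N] <= triangles e0 setT)%N.
Proof.
apply: (triangles_map (f := fun x : 'I_n => inord x)) => //.
  move=> x y; rewrite !inE !blow_part0 => x0 y0 /(congr1 val).
  by rewrite /= !inordK // => /val_inj.
  by move=> x _; rewrite inE.
move=> x y; rewrite !inE => /eqP x0 /eqP y0.
by rewrite /blow_up x0 y0 eqxx.
Qed.

End BlowUp.

(** * The choice of the threshold c, and the value of p *)

Definition cut_const (q : nat) : rat :=
  (4 * q.+3%:R ^+ 3 * (6 * q.+2%:R) * (loss_const q + 1))^-1.

Lemma loss_const_ge0 q : 0 <= loss_const q.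
Proof.
apply: divr_ge0; first exact: gap_const_ge0.
by apply: exprn_ge0; apply: ltW; exact: gmin_gt0.
Qed.

Lemma cut_const_gt0 q : 0 < cut_const q.
Proof.
have l0 := loss_const_ge0 q.
have h3 : 0 < q.+3%:R ^+ 3 :> rat by apply: exprn_gt0; rewrite ltr0n.
have h2 : 0 < q.+2%:R :> rat by rewrite ltr0n.
rewrite invr_gt0; apply: mulr_gt0; last lra.
by apply: mulr_gt0; lra.
Qed.

Lemma cut_const_small q : cut_const q * (4 * q.+3%:R ^+ 3) <= 1.
Proof.
have l0 := loss_const_ge0 q.
have h3 : 1 <= q.+3%:R ^+ 3 :> rat by apply: exprn_ege1; rewrite ler1n.
have h2 : 1 <= q.+2%:R :> rat by rewrite ler1n.
have := cut_const_gt0 q; rewrite /cut_const invr_gt0 => D0.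
rewrite mulrC ler_pdivrMr // mul1r; move: D0.
set l := loss_const q in l0 *; set P := q.+2%:R in h2 *; set X := q.+3%:R ^+ 3 in h3 *.
move=> _; have -> : 4 * X * (6 * P) * (l + 1) = (6 * P * (l + 1)) * (4 * X) by ring.
apply: ler_peMl; first lra.
apply: mulr_ege1; lra.
Qed.

Lemma cut_const_loss q : cut_const q * loss_const q * (6 * q.+2%:R) <= 1.
Proof.
have l0 := loss_const_ge0 q.
have h3 : 1 <= q.+3%:R ^+ 3 :> rat by apply: exprn_ege1; rewrite ler1n.
have h2 : 1 <= q.+2%:R :> rat by rewrite ler1n.
have := cut_const_gt0 q; rewrite /cut_const invr_gt0 => D0.
rewrite -mulrA mulrC ler_pdivrMr // mul1r; move: D0.
set l := loss_const q in l0 *; set P := q.+2%:R in h2 *; set X := q.+3%:R ^+ 3 in h3 *.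
move=> _; have h : l * (6 * P) <= (l + 1) * (6 * P) by apply: ler_wpM2r; lra.
apply: le_trans h _.
have -> : 4 * X * (6 * P) * (l + 1) = (4 * X) * ((l + 1) * (6 * P)) by ring.
by apply: ler_peMl; [apply: mulr_ge0; lra | lra].
Qed.

Lemma pof_unique q (beta : rat) : q.+2%:R^-1 <= beta -> beta * q.+1%:R < 1 ->
  pof beta = q.+1.
Proof.
move=> h1 h2; have b0 : 0 < beta by apply: lt_le_trans h1; rewrite invr_gt0 ltr0n.
rewrite /pof (@ceil_def _ _ q.+2%:Z); first by rewrite -[q.+2]addn1 PoszD addrK.
have -> : q.+2%:Z - 1 = q.+1%:Z by rewrite -[q.+2]addn1 PoszD addrK.
rewrite -!pmulrn; apply/andP; split.
  by rewrite -[beta^-1]mul1r ltr_pdivlMr // mulrC.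
by rewrite -[beta^-1]mul1r ler_pdivrMr // mulrC -ler_pdivrMr ?ltr0n // mul1r.
Qed.

(** * The theorem for fixed p, n and delta *)

Section Main.
Variables (q n delta : nat).
Let beta := beta_of n delta.
Local Notation P := (q.+2%:R : rat).
Local Notation N := (n%:R : rat).
Variable c : rat.
Hypotheses (c0 : 0 < c) (c_small : c * (4 * q.+3%:R ^+ 3) <= 1)
  (c_loss : c * loss_const q * (6 * P) <= 1).
Hypotheses (n0 : (0 < n)%N) (d0 : (0 < delta)%N).
Hypothesis lo : (1 - 1 / P - c ^+ 2 / P) * N < delta%:R.
Hypothesis hi : delta%:R <= (1 - 1 / P) * N.

Let N0 : 0 < N. Proof. by rewrite ltr0n. Qed.
Let P0 : 0 < P. Proof. by rewrite ltr0n. Qed.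

Lemma betaN : (1 - beta) * N = delta%:R.
Proof. by rewrite /beta /beta_of opprB addrC subrK divfK // gt_eqF. Qed.

Lemma main_xi_ge0 : 0 <= density_gap beta q.+1.
Proof.
rewrite /density_gap subr_ge0 mulrC -ler_pdivrMr // /beta /beta_of lerBrDl -lerBrDr.
by rewrite ler_pdivrMr.
Qed.

Lemma main_xi_le : density_gap beta q.+1 <= c ^+ 2.
Proof.
have h : 1 - 1 / P - c ^+ 2 / P < delta%:R / N by rewrite ltr_pdivlMr.
have : beta < (1 + c ^+ 2) / P.
  by rewrite mulrDl /beta /beta_of ltrBlDr -ltrBlDl opprD addrA.
by rewrite ltr_pdivlMr // /density_gap; lra.
Qed.

Let xi0 := main_xi_ge0.
Let xi_c := main_xi_le.
Let xs : density_gap beta q.+1 * (2 * q.+1%:R) <= 1 := xi_small n0 c0 xi0 c_small xi_c.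

Lemma main_pof : pof beta = q.+1.
Proof.
apply: pof_unique; first exact: beta_ge xi0.
have := ac_gt0 xi0 xs (leqnn q.+1); rewrite /low_density; lra.
Qed.

Lemma gE r : g r beta = gp q beta r.
Proof. by rewrite /g main_pof. Qed.

Section Graph.
Variable e : rel 'I_n.
Hypotheses (eG : simple_graph e) (md : min_degree_is e delta).

Lemma main_deg x : (1 - beta) * N <= (deg e x)%:R.
Proof. by rewrite betaN ler_nat; case: md. Qed.

Lemma krE r : (kr e r)%:R = clique_density e r * N ^+ r.
Proof. by rewrite divfK // expf_neq0 // gt_eqF. Qed.

Lemma main_lower r : (0 < r)%N -> g r beta * N ^+ r <= (kr e r)%:R.
Proof.
move=> r0; rewrite gE krE ler_pM2r ?exprn_gt0 //.
have [r3|] := leqP 3 r; last first.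
  case: r r0 => [|[|[|]]] // _ _; first by rewrite gp1 kap1.
  exact: (kap2_ge eG n0 main_deg q).
have [rq|rq] := leqP r q.+2; last by rewrite gp_big // kap_ge0.
have r3q : (3 <= r <= q.+2)%N by rewrite r3.
apply: le_trans (kap_ge eG n0 main_deg c0 xi0 c_small xi_c c_loss r3q).
rewrite ler_peMr ?(gp_ge0 xi0 xs) ?(ltnW r3) // lerDl divr_ge0 //.
exact: excess_ge0.
Qed.

Lemma main_equality r : (3 <= r <= q.+2)%N -> (kr e r)%:R = g r beta * N ^+ r ->
  (forall x, (deg e x)%:R = (1 - beta) * N) /\
  exists part, multipartite e beta q part /\ triangles e [set x | part x == 0%N] = 0%N.
Proof.
move=> r3 E; have kE : clique_density e r = gp q beta r.
  have Nr : N ^+ r != 0 by rewrite expf_neq0 // gt_eqF.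
  by apply: (mulIf Nr); rewrite -gE -krE.
have dE := eq_regular eG n0 main_deg c0 xi0 c_small xi_c c_loss r3 kE.
split=> //.
have nb := eq_no_big_clique eG n0 main_deg c0 xi0 c_small xi_c c_loss r3 kE.
have [h1 h2] := eq_slack eG n0 main_deg c0 xi0 c_small xi_c c_loss r3 kE.
(* Whichever r attains equality, the lower bound at level p + 1 provides a K_(p+1). *)
have kpos : 0 < clique_density e q.+2.
  have q1 := eq_q_gt0 r3.
  have T : (3 <= q.+2 <= q.+2)%N by rewrite leqnn andbT !ltnS.
  apply: lt_le_trans (kap_ge eG n0 main_deg c0 xi0 c_small xi_c c_loss T).
  apply: mulr_gt0; first by apply: (gp_gt0 xi0 xs); rewrite leqnn.
  by apply: ltr_wpDr => //; apply: divr_ge0 => //; exact: excess_ge0.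
have [T TK] : exists T, T \in cliques e q.+2.
  apply/set0Pn; apply: contraTneq kpos => E0.
  by rewrite /clique_density E0 cards0 mul0r ltxx.
have bE : high_density beta q.+1 q.+1 = beta by rewrite /high_density -(natr1 q.+1); ring.
apply: (extremal_structure eG n0 dE nb TK) => [S Sq|].
  by have := h1 S Sq; rewrite bE.
by apply/eqP; rewrite -subr_eq0; apply/eqP; exact: h2.
Qed.

End Graph.

Lemma family_multipartite (e : rel 'I_n) part :
  family_partition n delta e part -> multipartite e beta q part.
Proof.
rewrite /family_partition -/beta main_pof.
by move=> [lt [_ [sz [cr [ind _]]]]]; split.
Qed.

Lemma family_degree (e : rel 'I_n) part : family_partition n delta e part ->
  forall x, x \in [set z | part z == 0%N] ->
  #|[set y in [set z | part z == 0%N] | e x y]|%:R = (1 - q.+1%:R * beta) * N.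
Proof.
rewrite /family_partition -/beta main_pof.
by move=> [_ [_ [_ [_ [_ [dg _]]]]]].
Qed.

(** The handshake identity: n delta is twice the number of edges. *)
Lemma regular_not_odd (e : rel 'I_n) : simple_graph e ->
  (forall x, (deg e x)%:R = (1 - beta) * N) -> family_defined n delta.
Proof.
move=> eG dE; split=> //; split=> //.
have E : (n * delta = 2 * #|cliques e 2|)%N.
  apply/eqP; rewrite -(eqr_nat rat) !natrM; apply/eqP.
  have := avg_dens eG 1; rewrite avg_cliques1 // => E.
  have N0' : N != 0 by rewrite gt_eqF.
  have {}E : (\sum_x (deg e x)%:R) / N / N = 2 * clique_density e 2.
    rewrite -E mulr_suml; congr (_ / _); apply: eq_bigr => x _; congr (_ / _).
    rewrite -card_nbh -[[set x]]setU0 commonU1 //; congr (_%:R); apply: eq_card => y.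
    by rewrite !inE sub0set andbT.
  rewrite (eq_bigr (fun=> delta%:R)) in E; last by move=> x _; rewrite dE betaN.
  rewrite sumr_const card_ord -(mulr_natl delta%:R) /clique_density in E.
  have -> : N * delta%:R = N * delta%:R / N / N * N ^+ 2 by field.
  by rewrite E; field.
by rewrite -oddM E oddM.
Qed.

Lemma family_exists : family_defined n delta ->
  exists (e : rel 'I_n) (part : 'I_n -> nat),
    simple_graph e /\ family_partition n delta e part.
Proof.
move=> [_ [_ par]].
have N0' : N != 0 by rewrite gt_eqF.
have b0 : 0 < beta := beta_gt0 xi0.
have dn : (delta <= n)%N.
  by rewrite -(ler_nat rat) -betaN ler_piMl ?ler0n // gerBl ltW.
pose B := (n - delta)%N.
have BE : beta * N = B%:R by rewrite natrB // -betaN; ring.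
have B0 : (0 < B)%N by rewrite -(ltr0n rat) -BE mulr_gt0.
have pB : (q.+1 * B < n)%N.
  rewrite -(ltr_nat rat) natrM -BE mulrA gtr_pMl //.
  by have := ac_gt0 xi0 xs (leqnn q.+1); rewrite /low_density; lra.
have pB' : (B + q * B < n)%N by rewrite -mulSn.
(* B = beta n is the size of the independent parts, d the degree inside V_0, and d + B the order of
   V_0. *)
pose d := (n - q.+1 * B)%N.
have dE : (d + (B + q * B) = n)%N by rewrite -mulSn subnK // ltnW.
have [m mE] : exists m, (d + B = m.+1)%N by exists (d + B).-1; rewrite prednK // addn_gt0 B0 orbT.
have nE : n = (m.+1 + q * B)%N by rewrite -mE -addnA.
have dm : (d < m.+1)%N by rewrite -mE -addn1 leq_add2l.
(* If d and d + B were both odd, B would be even, and n = d + (q+1) B and delta = d + q B would both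
   be odd. *)
have par' : ~~ (odd m.+1 && odd d).
  have E3 : delta = (d + q * B)%N by apply: (@addIn B); rewrite addnAC -addnA dE subnKC.
  move: par; rewrite -mE -[in odd n]dE E3 !oddD !oddM /=.
  by case: (odd d); case: (odd B); case: (odd q).
have [e1 r1] := regular_exists dm par'.
have [e0 [r0 mn]] := min_triangles_exists r1.
(* The order is generalised so that its decomposition can be substituted in the type of the
   vertices, which is otherwise tied to n. *)
have H (n' : nat) (nE' : n' = (m.+1 + q * B)%N) (b' : rat) : b' * n'%:R = B%:R ->
  exists (e : rel 'I_n') (part : 'I_n' -> nat), simple_graph e /\ multipartite e b' q part /\
  (forall x, x \in [set z | part z == 0%N] ->
     #|[set y in [set z | part z == 0%N] | e x y]| = d) /\
  (triangles e [set z | part z == 0%N] <= triangles e0 setT)%N.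
  rewrite nE' => bE; exists (@blow_up m q B e0); exists (@blow_part m q B).
  split; first exact: blow_up_simple r0.
  split; first exact: blow_up_multipartite.
  by split; [exact: blow_up_deg0 | exact: blow_up_triangles].
have [e [part [eG [M [dg tr]]]]] := H n nE beta BE.
exists e, part; split=> //; rewrite /family_partition -/beta main_pof /=.
have V0 := multipartite_card0 M.
have dR : d%:R = (1 - q.+1%:R * beta) * N.
  have : (d + q.+1 * B)%:R = N by rewrite mulSn dE.
  by rewrite natrD natrM -BE; lra.
case: (M) => lt sz cr ind; split=> //; split=> //; split=> //; split=> //; split=> //.
split=> [x x0|]; first by rewrite dg.
move=> m' e' eG' mE' dg'; apply: leq_trans tr _.
have mm : m' = m.+1.
  apply/eqP; rewrite -(eqr_nat rat) mE' -mE natrD dR -BE -(natr1 q); apply/eqP; ring.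
move: e' eG' dg' {mE'}; rewrite mm => e' eG' dg'.
apply: mn; split=> // x; apply/eqP; rewrite -(eqr_nat rat) dR; apply/eqP; exact: dg'.
Qed.

Lemma family_equality (e : rel 'I_n) part r : simple_graph e ->
  family_partition n delta e part -> triangles e [set x | part x == 0%N] = 0%N ->
  (2 <= r)%N -> min_degree_is e delta /\ (kr e r)%:R = g r beta * N ^+ r.
Proof.
move=> eG fp t0 r2; have M := family_multipartite fp; have dg := family_degree fp.
split; last by rewrite krE gE (family_kap eG n0 M dg t0 r2).
have dE x : deg e x = delta.
  by apply/eqP; rewrite -(eqr_nat rat) (family_deg M dg) betaN.
by split; [move=> x; rewrite dE | exists (Ordinal n0)].
Qed.

(** The part V_0 found has no triangle, so its minimality is immediate. Feasibility concerns every
    other member as well: the minimality of that member is applied to the graph induced on this V_0,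
    relabelled by ordinals, and forces its triangle count to be 0. *)
Lemma equality_family (e : rel 'I_n) r : simple_graph e -> min_degree_is e delta ->
  (3 <= r <= q.+2)%N -> (kr e r)%:R = g r beta * N ^+ r ->
  in_family n delta e /\ feasible n delta.
Proof.
move=> eG md r3 E; have [dE [part [M t0]]] := main_equality eG md r3 E.
have fd := regular_not_odd eG dE.
have V0 := multipartite_card0 M.
have dg x : x \in [set z | part z == 0%N] ->
    #|[set y in [set z | part z == 0%N] | e x y]|%:R = (1 - q.+1%:R * beta) * N.
  by rewrite inE => /eqP; exact: multipartite_deg0.
split.
  split=> //; split=> //; exists part; rewrite /family_partition -/beta main_pof /=.
  case: (M) => lt sz cr ind; do 6 (split=> //).
  by move=> m' e' _ _ _; rewrite t0.
split=> // e1 part1 eG1; rewrite /family_partition -/beta main_pof /=.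
move=> [_ [_ [_ [_ [_ [_ mn]]]]]].
set V := [set z | part z == 0%N] in V0 dg t0.
have [eI dI] := induced_regular V eG.
have := mn _ _ eI V0; move/(_ (fun i => etrans (congr1 (fun k => k%:R) (dI i)) (dg _ (enum_valP i)))).
move=> h; apply/eqP; rewrite -leqn0; apply: leq_trans h _.
rewrite -[X in (_ <= X)%N]t0; apply: (triangles_map (f := enum_val)) => //.
  by move=> x y _ _; exact: enum_val_inj.
by move=> x _; exact: enum_valP.
Qed.

End Main.

Theorem mainTheorem4 :
  forall p : nat, (0 < p)%N ->
  exists eps : rat, 0 < eps /\
  forall n delta : nat, (0 < n)%N -> (0 < delta)%N ->
    (1 - 1 / (p.+1)%:R - eps) * n%:R < delta%:R ->
    (delta%:R : rat) <= (1 - 1 / (p.+1)%:R) * n%:R ->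
    let beta := beta_of n delta in
    (forall r : nat, (0 < r)%N ->
       forall e : rel 'I_n, simple_graph e -> min_degree_is e delta ->
         g r beta * n%:R ^+ r <= (kr e r)%:R)
    /\
    (forall r : nat, (3 <= r <= p.+1)%N ->
       ((exists e : rel 'I_n, [/\ simple_graph e, min_degree_is e delta &
            ((kr e r)%:R : rat) = g r beta * n%:R ^+ r])
          <-> feasible n delta)
       /\
       (feasible n delta ->
          forall e : rel 'I_n,
            [/\ simple_graph e, min_degree_is e delta &
                ((kr e r)%:R : rat) = g r beta * n%:R ^+ r]
            <-> in_family n delta e)).
Proof.
case=> // q _.
have c0 := cut_const_gt0 q; have cs := cut_const_small q; have cl := cut_const_loss q.
set c := cut_const q in c0 cs cl.
(* Since xi = P beta - 1, an allowance of c^2/P in delta/n is an allowance of c^2 in xi. *)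
exists (c ^+ 2 / q.+2%:R); split; first by rewrite divr_gt0 ?exprn_gt0 // ltr0n.
move=> n delta n0 d0 lo hi beta; split=> [r r0 e eG md|r r3].
  exact: (main_lower c0 cs cl n0 lo hi eG md r0).
have r2 : (2 <= r)%N by case/andP: r3 => /ltnW.
split; last first.
  move=> [_ feas] e; split=> [[eG md E]|[fd [eG [part fp]]]].
    by have [] := equality_family c0 cs cl n0 d0 lo hi eG md r3 E.
  by have [] := family_equality c0 cs n0 lo hi eG fp (feas _ _ eG fp) r2; split.
split=> [[e [eG md E]]|[fd feas]].
  by have [] := equality_family c0 cs cl n0 d0 lo hi eG md r3 E.
have [e [part [eG fp]]] := family_exists c0 cs n0 lo hi fd.
by have [md E] := family_equality c0 cs n0 lo hi eG fp (feas _ _ eG fp) r2; exists e; split.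
Qed.
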